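(* Let $n\ge 2$ and let $\mathcal{I}$ be a partial inversive plane, i.e. a partial $3$-$(n^2+1,n+1,1)$-design. Suppose that for every point $P$ of $\mathcal{I}$ at least one of the following holds: (i) there are at least $n^2+n-\sqrt n$ circles through $P$, and parallelism is an equivalence relation in $\mathcal{I}_P$; (ii) there is at most one point in $\mathcal{I}_P$ of valency less than $n$, and parallelism is an equivalence relation in $\mathcal{I}_P$; (iii) writing the number of lines of $\mathcal{I}_P$ as $n^2+n-e$, at least one of the following holds: (a) $e<\sqrt n+1$ and there is a point of $\mathcal{I}_P$ of valency $n+1-e$; (b) $e<\sqrt n$ and some line of $\mathcal{I}_P$ contains only points of valency $n+1$ in $\mathcal{I}_P$; (c) $n\ge 2$ and $e=1$; (d) $n\ge 4$ and $e=2$. Then $\mathcal{I}$ can be completed to an inversive plane, i.e. to a $3$-$(n^2+1,n+1,1)$-design.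
   Context: A $t$-$(v,k,\lambda)$-design (respectively partial $t$-$(v,k,\lambda)$-design) is an incidence structure consisting of a set of $v$ points and a set of $k$-element subsets of points (blocks) such that every set of $t$ points lies in exactly (respectively at most) $\lambda$ blocks. For $t=2$ blocks are called lines; for $t=3$ blocks are called circles. A partial design can be completed to a (full) design if there is a full design with the same parameters on the same point set whose block set contains the given block set. For a partial $3$-$(n^2+1,n+1,1)$-design $\mathcal{I}$ and a point $P$, the derived structure $\mathcal{I}_P$ has as points the points of $\mathcal{I}$ different from $P$, and as lines the sets $C\setminus\{P\}$ for circles $C$ of $\mathcal{I}$ containing $P$; it is a partial $2$-$(n^2,n,1)$-design. The valency of a point in $\mathcal{I}_P$ is the number of lines of $\mathcal{I}_P$ containing it. Two lines are parallel if they coincide or have no point in common. *)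

(* Defs.v *)
From mathcomp Require Import all_boot all_order all_algebra.

Set Implicit Arguments.
Unset Strict Implicit.
Unset Printing Implicit Defensive.

(* The point set is a subset of an ambient finite type, so that a derived
   structure lives on the same type as the structure it comes from. *)
Record incidence (T : finType) := Incidence {
  points : {set T};
  blocks : {set {set T}}
}.

Definition blocks_on (T : finType) (I : incidence T) (S : {set T}) :
    {set {set T}} :=
  [set B in blocks I | S \subset B].

Definition block_size (T : finType) (k : nat) (I : incidence T) : Prop :=
  forall B : {set T}, B \in blocks I -> B \subset points I /\ #|B| = k.

Definition is_partial_design (T : finType) (t v k lam : nat)
    (I : incidence T) : Prop :=
  [/\ #|points I| = v,
      block_size k I &
      forall S : {set T}, S \subset points I -> #|S| = t ->
        #|blocks_on I S| <= lam].

Definition is_design (T : finType) (t v k lam : nat)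
    (I : incidence T) : Prop :=
  [/\ #|points I| = v,
      block_size k I &
      forall S : {set T}, S \subset points I -> #|S| = t ->
        #|blocks_on I S| = lam].

Definition completable (T : finType) (t v k lam : nat)
    (I : incidence T) : Prop :=
  exists J : incidence T,
    [/\ is_design t v k lam J,
        points J = points I &
        blocks I \subset blocks J].

Definition derived (T : finType) (I : incidence T) (P : T) : incidence T :=
  Incidence (points I :\ P) [set C :\ P | C in blocks I & P \in C].

Definition valency (T : finType) (I : incidence T) (Q : T) : nat :=
  #|[set L in blocks I | Q \in L]|.

Definition parallel (T : finType) : rel {set T} :=
  fun L M => (L == M) || [disjoint L & M].

Definition parallelism_equiv (T : finType) (I : incidence T) : Prop :=
  {in blocks I & &, equivalence_rel (@parallel T)}.

Local Open Scope ring_scope.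

(* [R] is the real closed field (e.g. the reals) in which the square root of
   [n] is taken; it only serves to compare integers with that root. *)
Definition cond_i (R : rcfType) (T : finType) (n : nat) (I : incidence T)
    (P : T) : Prop :=
  (n ^ 2 + n)%:R - Num.sqrt (n%:R : R)
    <= #|[set C in blocks I | P \in C]|%:R
  /\ parallelism_equiv (derived I P).

Definition cond_ii (T : finType) (n : nat) (I : incidence T) (P : T) : Prop :=
  (#|[set Q in points (derived I P) | (valency (derived I P) Q < n)%N]| <= 1)%N
  /\ parallelism_equiv (derived I P).

Definition cond_iii (R : rcfType) (T : finType) (n : nat) (I : incidence T)
    (P : T) : Prop :=
  (* [e] is determined by [I], [P] and [n]; it is an integer so that the
     differences are not truncated. *)
  exists2 e : int,
    #|blocks (derived I P)|%:Z = (n ^ 2 + n)%:Z - e &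
    [\/ e%:~R < Num.sqrt (n%:R : R) + 1 /\
        (exists2 Q : T, Q \in points (derived I P) &
           (valency (derived I P) Q)%:Z = n%:Z + 1 - e),
        e%:~R < Num.sqrt (n%:R : R) /\
        (exists2 L : {set T}, L \in blocks (derived I P) &
           forall Q : T, Q \in L -> valency (derived I P) Q = n.+1),
        (2 <= n)%N /\ e = 1 |
        (4 <= n)%N /\ e = 2].

(* Main.v *)
Require Import Defs.
From mathcomp Require Import all_boot all_order all_algebra.
From mathcomp Require Import zify.

(* Complete each derived structure I_P to an affine plane, i.e. partition the
   graph "x and y are not on a common line" of I_P into n-cliques.  For a point
   x through which a single line is missing the candidate is forced: it is the
   star of x, that is x with all points not joined to x.  So one shows that
   these stars are cliques and that points with two missing lines are rare.
   If parallelism is transitive, two joined points of the star of x would lie on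
   a line with two parallels through x.  If all missing lines pass through one
   point, or dually if some line has only points of full valency, there is a
   net (or dual net) in which the stars (or parallel classes) are transversals,
   and Bruck's bound makes two transversals with two common points equal.  If
   e = 2 one of these cases applies, except for n = 4, which is a parity argument
   on permutations of four letters.
   It remains to see that the missing lines of the various I_P fit together: if
   L is missing in I_P and Q is on L, then L - Q + P is missing in I_Q.  The
   number of missing lines through Q in I_P is symmetric in P and Q, as both
   count the points R with PQR on no circle.  If this number is 1 the claim is
   immediate; otherwise, missing lines being few, some R on L has this number
   equal to 1 with both P and Q, and one passes from P to R to Q. *)

Set Implicit Arguments.
Unset Strict Implicit.
Unset Printing Implicit Defensive.

Import Order.TTheory GRing.Theory Num.Theory.

(** * Double counting *)

(** The bounds on e are instances of Bruck's condition (n - k)^2 < n. If all missing lines pass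
    through Q, the lines through Q and their parallels form a net of degree k = n + 1 - e, and the
    condition reads (e - 1)^2 < n. A line of full points gives a dual net of degree k = n - e, and
    it reads e^2 < n; for e = 2 and n >= 4 this fails only at n = 4. Gluing is not automatic: the
    decompositions at different points are chosen independently, and a missing line all of whose
    points have several missing lines would not be forced by any star. The local result therefore
    also records that at most one point is [deep] or that e^2 <= n; either leaves enough points of
    lack 1 on every missing line. *)

Lemma card_le1_in (T : finType) (A : {set T}) :
  (forall x y, x \in A -> y \in A -> x = y) -> #|A| <= 1.
Proof.
by move=> H; apply/card_le1_eqP => x y xA yA; apply: H.
Qed.

Lemma double_count_rel (S T : finType) (A : {set S}) (B : {set T})
    (r : S -> T -> bool) :
  \sum_(a in A) #|[set b in B | r a b]| = \sum_(b in B) #|[set a in A | r a b]|.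
Proof.
transitivity (\sum_(a in A) \sum_(b in B) (r a b : nat)).
  apply: eq_bigr => a _; rewrite -sum1_card big_mkcond [RHS]big_mkcond.
  by apply: eq_bigr => b _; rewrite inE; case: (b \in B); case: (r a b).
rewrite exchange_big; apply: eq_bigr => b _.
rewrite -sum1_card big_mkcond [RHS]big_mkcond.
by apply: eq_bigr => a _; rewrite inE; case: (a \in A); case: (r a b).
Qed.

(** A relation replaces an injection, so that no choice function has to be built. *)
Lemma card_le_rel (S T : finType) (A : {set S}) (B : {set T})
    (r : S -> T -> bool) :
  (forall a, a \in A -> exists2 b, b \in B & r a b) ->
  (forall a a' b, a \in A -> a' \in A -> b \in B -> r a b -> r a' b -> a = a') ->
  #|A| <= #|B|.
Proof.
move=> ex un; rewrite -!sum1_card.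
apply: (@leq_trans (\sum_(a in A) #|[set b in B | r a b]|)).
  apply: leq_sum => a /ex [b bB rab]; rewrite card_gt0; apply/set0Pn.
  by exists b; rewrite inE bB.
rewrite double_count_rel; apply: leq_sum => b bB; apply: card_le1_in => a a'.
by rewrite !inE => /andP [aA ra] /andP [aA' ra']; exact: un aA aA' bB ra ra'.
Qed.

Lemma double_count (T : finType) (F : {set {set T}}) (S : {set T}) :
  \sum_(b in F) #|b :&: S| = \sum_(x in S) #|[set b in F | x \in b]|.
Proof.
rewrite -(double_count_rel F S (fun b x => x \in b)); apply: eq_bigr => b _.
by apply: eq_card => x; rewrite !inE andbC.
Qed.

Lemma sum_mem_card (T : finType) (A S : {set T}) :
  \sum_(x in A) (x \in S : nat) = #|A :&: S|.
Proof.
rewrite -sum1_card big_mkcond [RHS]big_mkcond.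
by apply: eq_bigr => x _; rewrite inE; case: (x \in A); case: (x \in S).
Qed.

Lemma card_gt1_ex (T : finType) (A : {set T}) :
  1 < #|A| -> exists x y, [/\ x \in A, y \in A & x != y].
Proof. by case/card_gt1P => x [y [? ? ?]]; exists x, y. Qed.

(** * Partial affine planes *)

Record plane (T : finType) (n : nat) (V : {set T}) (B : {set {set T}}) : Prop :=
  Plane {
  plane_order : 1 < n;
  plane_points : #|V| = n ^ 2;
  line_sub : forall b, b \in B -> b \subset V;
  line_card : forall b, b \in B -> #|b| = n;
  line_uniq : forall b c x y, b \in B -> c \in B -> x != y ->
    x \in b -> y \in b -> x \in c -> y \in c -> b = c }.

Section Notions.
Variables (T : finType) (n : nat) (V : {set T}) (B : {set {set T}}).

Definition pencil (x : T) := [set b in B | x \in b].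
Definition joined (x y : T) := [exists b in B, (x \in b) && (y \in b)].
Definition far (x : T) := [set y in V | (y != x) && ~~ joined x y].
Definition star (x : T) := x |: far x.
(* The number of lines missing through x; by [pencil_lack] the subtraction is
   never truncated. *)
Definition lack (x : T) := n.+1 - #|pencil x|.
Definition misses (x : T) (L : {set T}) := [set b in pencil x | [disjoint b & L]].
Definition pclass (L : {set T}) := [set b in B | parallel L b].

(** The members of M are the missing lines: together with B they form an affine plane on V. *)
Definition decomposes (M : {set {set T}}) : Prop :=
  [/\ forall m, m \in M -> m \subset V /\ #|m| = n,
      forall m x y, m \in M -> x \in m -> y \in m -> x != y -> y \in far x,
      forall x y, x \in V -> y \in far x ->
        exists m, [/\ m \in M, x \in m & y \in m] &
      forall m m' x y, m \in M -> m' \in M -> x != y ->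
        x \in m -> y \in m -> x \in m' -> y \in m' -> m = m'].
End Notions.

(** * Counting points, lines and missing lines *)

Section Basic.
Variables (T : finType) (n : nat) (V : {set T}) (B : {set {set T}}).
Hypothesis pl : plane n V B.
Notation pencil := (pencil B).
Notation joined := (joined B).
Notation far := (far V B).
Notation star := (star V B).
Notation lack := (lack n B).
Notation misses := (misses B).
Notation pclass := (pclass B).

Let n1 : 1 < n := plane_order pl.

Lemma joinedC x y : joined x y = joined y x.
Proof. by apply: eq_existsb => b; rewrite (andbC (x \in b)). Qed.

Lemma joinedP x y : reflect (exists b, [/\ b \in B, x \in b & y \in b]) (joined x y).
Proof.
apply: (iffP exists_inP) => [[b bB /andP [xb yb]]|[b [bB xb yb]]]; exists b => //.
by rewrite xb yb.
Qed.

Lemma far_sym x y : x \in V -> y \in far x -> x \in far y.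
Proof. by move=> xV; rewrite !inE => /and3P [_ yx]; rewrite xV eq_sym yx joinedC. Qed.

Lemma far_V x y : y \in far x -> y \in V.
Proof. by rewrite !inE => /andP []. Qed.

Lemma far_neq x y : y \in far x -> y != x.
Proof. by rewrite !inE => /and3P []. Qed.

Lemma far_line x y b : y \in far x -> b \in B -> x \in b -> y \in b -> False.
Proof.
rewrite !inE => /and3P [_ _ /joinedP J] bB xb yb; apply: J.
by exists b.
Qed.

Lemma farP x y : y \in V -> y != x ->
  (forall b, b \in B -> x \in b -> y \in b -> False) -> y \in far x.
Proof.
move=> yV yx H; rewrite !inE yV yx /=; apply/joinedP => -[b [bB xb yb]].
exact: (H b).
Qed.

Lemma line_V b x : b \in B -> x \in b -> x \in V.
Proof. by move=> /(line_sub pl)/subsetP; apply. Qed.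

Lemma card_joining x y : x != y ->
  #|[set b in pencil x | y \in b]| = joined x y.
Proof.
move=> xy; case: (joinedP x y) => [[b [bB xb yb]]|J].
  apply/eqP/cards1P; exists b; apply/setP => c; rewrite !inE.
  apply/idP/eqP => [/andP [/andP [cB xc] yc]|->]; last by rewrite bB xb yb.
  exact: (line_uniq pl cB bB xy).
apply/eqP; rewrite cards_eq0; apply/eqP/setP => c; rewrite !inE.
by apply/negP => /andP [/andP [cB xc] yc]; apply: J; exists c.
Qed.

Lemma card_meet b c : b \in B -> c \in B -> b != c ->
  #|b :&: c| = ~~ [disjoint b & c].
Proof.
move=> bB cB bc; have : #|b :&: c| <= 1.
  apply: card_le1_in => x y; rewrite !inE => /andP [xb xc] /andP [yb yc].
  apply/eqP/negPn/negP => xy; case/eqP: bc.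
  exact: (line_uniq pl bB cB xy).
rewrite -setI_eq0 -cards_eq0; by case: #|_| => [|[|k]].
Qed.

(** The lines through x partition the points joined to x, with n - 1 of them on each. *)
Lemma pencil_far x : x \in V -> #|pencil x| * n.-1 + #|far x| = (n ^ 2).-1.
Proof.
move=> xV; have := double_count (pencil x) (V :\ x).
have cV : #|V :\ x| = (n ^ 2).-1 by rewrite -(plane_points pl) [#|V|](cardsD1 x) xV.
rewrite (eq_bigr (fun _ => n.-1)); last first.
  move=> b; rewrite inE => /andP [bB xb].
  have -> : b :&: (V :\ x) = b :\ x.
    apply/setP => y; rewrite !inE; case yb: (y \in b) => //=; rewrite ?andbF //.
    by rewrite (line_V bB yb).
  by have := line_card pl bB; rewrite (cardsD1 x b) xb => <-.
rewrite sum_nat_const => ->.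
rewrite (eq_bigr (fun y => (y \in [set y | joined x y] : nat))); last first.
  by move=> y; rewrite !inE => /andP [yx yV]; rewrite card_joining // eq_sym.
rewrite sum_mem_card -cV -(cardsID [set y | joined x y] (V :\ x)).
congr (_ + _); apply: eq_card => y; rewrite !inE.
by case: (y \in V); case: (y == x); case: (joined x y).
Qed.

Lemma pencil_lack x : x \in V -> #|pencil x| + lack x = n.+1.
Proof.
move=> xV; have := pencil_far xV; rewrite /lack.
move: (#|pencil x|) (#|far x|) => v f H.
suff : v <= n.+1 by lia.
nia.
Qed.

Lemma card_far x : x \in V -> #|far x| = lack x * n.-1.
Proof.
move=> xV; have := pencil_far xV; have := pencil_lack xV.
move: (#|pencil x|) (#|far x|) (lack x) => v f d H1 H2.
have : (v + d) * n.-1 = n.+1 * n.-1 by rewrite H1.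
nia.
Qed.

Lemma far_lack x y : x \in V -> y \in far x -> 0 < lack x.
Proof.
move=> xV yx; have := card_far xV; case: (lack x) => // /eqP.
by rewrite mul0n cards_eq0 => /eqP E; move: yx; rewrite E inE.
Qed.

Lemma far_lack_r x y : x \in V -> y \in far x -> 0 < lack y.
Proof. by move=> xV yx; apply: far_lack (far_V yx) (far_sym xV yx). Qed.

Lemma card_star x : x \in V -> lack x = 1 -> #|star x| = n.
Proof.
move=> xV d1; rewrite cardsU1 !inE eqxx andbF card_far // d1 mul1n; lia.
Qed.

Lemma star_V x : x \in V -> star x \subset V.
Proof.
move=> xV; apply/subsetP => y; rewrite in_setU1 => /orP [/eqP ->//|]; exact: far_V.
Qed.

Lemma missesP (b : {set T}) x (L : {set T}) :
  reflect [/\ b \in B, x \in b & [disjoint b & L]] (b \in misses x L).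
Proof.
rewrite !inE -andbA; exact: and3P.
Qed.

(** The lines through x that meet L correspond to the points of L joined to x, so n + 1 - [lack x] -
    |[misses x L]| = n - |L :&: [far x]|. Most of the later arguments turn far points on L into
    parallels of L, or back, by this identity. *)
Lemma misses_far x L : L \in B -> x \in V -> x \notin L ->
  #|L :&: far x|.+1 = lack x + #|misses x L|.
Proof.
move=> LB xV xL; have := double_count (pencil x) L.
rewrite (eq_bigr (fun b => (b \in ~: misses x L) : nat)); last first.
  move=> b /[!inE] /andP [bB xb]; rewrite bB xb /= card_meet //.
  by apply: contraNneq xL => <-.
rewrite sum_mem_card -setDE cardsD.
have -> : pencil x :&: misses x L = misses x L.
  by apply/setIidPr/subsetP => b /[!inE] /andP [].
rewrite (eq_bigr (fun y => (y \in [set y | joined x y] : nat))); last first.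
  move=> y yL; rewrite inE card_joining //.
  by apply: contraNneq xL => ->.
rewrite sum_mem_card.
have := cardsID [set y | joined x y] L; rewrite (line_card pl LB).
have -> : L :\: [set y | joined x y] = L :&: far x.
  apply/setP => y; rewrite !inE; case yL: (y \in L); rewrite ?andbF //=.
  rewrite (line_V LB yL) /= andbT; case: eqP => // yx.
  by move: xL; rewrite -yx yL.
have : #|misses x L| <= #|pencil x| by apply/subset_leq_card/subsetP =>
  b /[!inE] /andP [].
have := pencil_lack xV; lia.
Qed.

(** A point x of L is on n - [lack x] further lines, so n^2 minus the sum of the lacks on L is the
    number of lines not parallel to L. *)
Lemma card_pclass L : L \in B ->
  #|pclass L| + n ^ 2 = #|B| + \sum_(x in L) lack x.
Proof.
move=> LB; have := double_count (B :\ L) L.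
rewrite (eq_bigr (fun b => (b \in ~: pclass L) : nat)); last first.
  move=> b /[!inE] /andP [bL bB]; rewrite bB /parallel eq_sym (negbTE bL) /=.
  by rewrite card_meet // disjoint_sym.
rewrite sum_mem_card => E.
have E2 : \sum_(x in L) #|[set b in B :\ L | x \in b]| + \sum_(x in L) lack x = n * n.
  rewrite -big_split /=; transitivity (\sum_(x in L) n); last first.
    by rewrite sum_nat_const (line_card pl LB).
  apply: eq_bigr => x xL; have := pencil_lack (line_V LB xL).
  have -> : [set b in B :\ L | x \in b] = pencil x :\ L.
    by apply/setP => b; rewrite !inE andbA.
  rewrite (cardsD1 L (pencil x)) inE LB xL /=; lia.
have E3 : (B :\ L) :&: ~: pclass L = B :\: pclass L.
  apply/setP => b; rewrite !inE /parallel; rewrite [L == b]eq_sym.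
  by case: (b \in B); case: (b == L); case: [disjoint _ & _].
have := cardsID (pclass L) B; have -> : B :&: pclass L = pclass L.
  by apply/setIidPr/subsetP => b /[!inE] /andP [].
rewrite -E3 E; lia.
Qed.

Lemma sum_lack e : #|B| + e = n ^ 2 + n -> \sum_(x in V) lack x = n * e.
Proof.
move=> He; have := double_count B V.
rewrite (eq_bigr (fun => n)) ?sum_nat_const; last first.
  by move=> b bB; rewrite (setIidPl (line_sub pl bB)) (line_card pl bB).
move=> E; have : \sum_(x in V) #|pencil x| + \sum_(x in V) lack x = n ^ 2 * n.+1.
  rewrite -big_split -(plane_points pl) -sum_nat_const.
  by apply: eq_bigr => x xV; rewrite /= pencil_lack.
rewrite -E; nia.
Qed.

Lemma card_lines : #|B| <= n ^ 2 + n.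
Proof.
have := double_count B V.
rewrite (eq_bigr (fun => n)) ?sum_nat_const; last first.
  by move=> b bB; rewrite (setIidPl (line_sub pl bB)) (line_card pl bB).
move=> E; have : \sum_(x in V) #|pencil x| + \sum_(x in V) lack x = n ^ 2 * n.+1.
  rewrite -big_split -(plane_points pl) -sum_nat_const.
  by apply: eq_bigr => x xV; rewrite /= pencil_lack.
rewrite -E; nia.
Qed.

Lemma mem_pclass b L : b \in pclass L = (b \in B) && parallel L b.
Proof. by rewrite inE. Qed.

Lemma parallelP (b c : {set T}) : reflect (b = c \/ [disjoint b & c]) (parallel b c).
Proof. apply: (iffP orP) => -[/eqP|]; by auto. Qed.

Lemma parallelC (b c : {set T}) : parallel b c = parallel c b.
Proof. by rewrite /parallel eq_sym disjoint_sym. Qed.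

Lemma disjointF (b c : {set T}) x : [disjoint b & c] -> x \in b -> x \in c -> False.
Proof. by move=> /disjoint_setI0 E xb xc; have := in_setI x b c;
  rewrite E inE xb xc. Qed.

Lemma parallel_eq (b c : {set T}) x : parallel b c -> x \in b -> x \in c -> b = c.
Proof. by case/parallelP => // bc xb xc; case: (disjointF bc xb xc). Qed.

Lemma not_parallel (b c : {set T}) : ~~ parallel b c ->
  b != c /\ exists2 x, x \in b & x \in c.
Proof.
rewrite negb_or => /andP [? /pred0Pn [x /= /andP [? ?]]]; split => //; by exists x.
Qed.

Lemma card_joined_pencil x (S : {set T}) : x \notin S -> x \in V -> S \subset V ->
  \sum_(b in pencil x) #|b :&: S| + #|S :&: far x| = #|S|.
Proof.
move=> xS xV sV; rewrite double_count.
rewrite (eq_bigr (fun y => (y \in [set y | joined x y]) : nat)); last first.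
  by move=> y yS; rewrite inE card_joining //; apply: contraNneq xS => ->.
rewrite sum_mem_card -[RHS](cardsID [set y | joined x y]); congr (_ + _).
apply: eq_card => y; rewrite !inE; case yS: (y \in S); rewrite ?andbF //=.
rewrite (subsetP sV _ yS) andbT /=; case: eqP => // yx.
by move: xS; rewrite -yx yS.
Qed.

Lemma pclass_at (L : {set T}) x : x \notin L ->
  #|[set b in pclass L | x \in b]| = #|misses x L|.
Proof.
move=> xL; apply: eq_card => b; rewrite inE mem_pclass.
apply/idP/missesP => [/andP [/andP [bB Lb] xb]|[bB xb db]].
  split=> //; rewrite disjoint_sym; case/parallelP: Lb => // Lb.
  by rewrite Lb xb in xL.
by rewrite bB xb /parallel disjoint_sym db orbT.
Qed.

Lemma pclass_at_in (L : {set T}) x : L \in B -> x \in L ->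
  #|[set b in pclass L | x \in b]| = 1.
Proof.
move=> LB xL; apply/eqP/cards1P; exists L; apply/setP => b; rewrite !inE.
apply/idP/eqP => [/andP [/andP [bB Lb] xb]|->].
  exact/esym/(parallel_eq Lb xL xb).
by rewrite LB xL /parallel eqxx.
Qed.

(** The [lack x] * (n - 1) far points of x have positive lack, so together with x they contribute at
    least n * [lack x] to the total n * e. *)
Lemma lack_le e x : #|B| + e = n ^ 2 + n -> x \in V -> lack x <= e.
Proof.
move=> He xV; have := sum_lack He; rewrite (bigD1 x) //=.
have : \sum_(y in V | y != x) (y \in far x) <= \sum_(y in V | y != x) lack y.
  apply: leq_sum => y _; case yx: (y \in far x) => //; exact: far_lack_r yx.
have -> : \sum_(y in V | y != x) (y \in far x) = #|far x|.
  transitivity #|(V :\ x) :&: far x|.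
    by rewrite -sum_mem_card; apply: eq_bigl => y; rewrite in_setD1 andbC.
  congr #|pred_of_set _|; apply/setIidPr/subsetP => y yx.
  by rewrite in_setD1 (far_V yx) (far_neq yx).
rewrite card_far // => H1 H2; have : lack x * n <= n * e.
  by rewrite -H2 -[in X in _ * X](prednK (ltnW n1)) mulnS leq_add2l.
by rewrite mulnC leq_pmul2l // ltnW.
Qed.

End Basic.

(** * Cliques of unjoined points *)

Section Decomposition.
Variables (T : finType) (n : nat) (V : {set T}) (B : {set {set T}}).
Hypothesis pl : plane n V B.
Notation far := (far V B).
Notation star := (star V B).
Notation lack := (lack n B).
Notation misses := (misses B).

Let n1 : 1 < n := plane_order pl.

(** The cliques through x cut [far x] into parts of n - 1 points; compare [card_far]. *)
Lemma decomposes_lack M x : decomposes n V B M -> x \in V ->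
  #|[set m in M | x \in m]| = lack x.
Proof.
case=> Mn Mfar Mcov Muniq xV; set P := [set m in M | x \in m].
have := double_count P (far x).
rewrite (eq_bigr (fun=> n.-1)) ?sum_nat_const; last first.
  move=> m /[!inE] /andP [mM xm]; have [mV mn] := Mn _ mM.
  have -> : m :&: far x = m :\ x.
    apply/setP => y; rewrite [LHS]inE [RHS]inE in_set1 [RHS]andbC.
    case ym: (y \in m) => //=; apply/idP/idP => [/far_neq //|yx].
    by apply: (Mfar m) => //; rewrite eq_sym.
  by rewrite -mn (cardsD1 x m) xm.
rewrite (eq_bigr (fun=> 1)); last first.
  move=> y yx; have [m [mM xm ym]] := Mcov x y xV yx.
  apply/eqP/cards1P; exists m; apply/setP => c; rewrite !inE.
  apply/idP/eqP => [/andP [/andP [cM xc] yc]|->]; last by rewrite mM xm ym.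
  by apply: (Muniq c m y x) => //; apply: far_neq yx.
rewrite sum1_card (card_far pl xV) => /eqP; rewrite eqn_pmul2r; last lia.
by move/eqP.
Qed.

Lemma decomposes_card M e : decomposes n V B M -> #|B| + e = n ^ 2 + n ->
  #|M| = e.
Proof.
move=> dM He; have [Mn _ _ _] := dM; have := double_count M V.
rewrite (eq_bigr (fun=> n)) ?sum_nat_const; last first.
  by move=> m /Mn [/setIidPl -> ->].
rewrite (eq_bigr lack); last by move=> x xV; rewrite decomposes_lack.
rewrite (sum_lack pl He) mulnC => /eqP; rewrite eqn_pmul2l; last lia.
by move/eqP.
Qed.

Definition clique_stars := forall x y z, x \in V -> lack x = 1 ->
  y \in star x -> z \in star x -> y != z -> z \in far y.

(** A line K joining two far points of x would, by [misses_far] with [lack x] = 1, be missed by two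
    lines through x. *)
Lemma clique_stars_misses :
  (forall x K, x \in V -> K \in B -> lack x = 1 -> x \notin K ->
    #|misses x K| <= 1) -> clique_stars.
Proof.
move=> H x y z xV d1; rewrite !in_setU1 => /orP [/eqP ->|yx] /orP [/eqP ->|zx].
- by rewrite eqxx.
- by [].
- by move=> _; apply: far_sym.
move=> yz; apply: farP; rewrite ?(far_V zx) 1?eq_sym //.
move=> K KB yK zK; have xK : x \notin K.
  by apply/negP => xK; apply: (far_line yx KB).
have := misses_far pl KB xV xK; have := H x K xV KB d1 xK; rewrite d1.
suff : 1 < #|K :&: far x| by lia.
by apply/card_gt1P; exists y, z; rewrite !inE in yx zx *; rewrite yK zK yx zx.
Qed.

Lemma star_eq x y : clique_stars -> x \in V -> lack x = 1 -> y \in star x ->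
  lack y = 1 -> star y = star x.
Proof.
move=> cl xV dx yx dy; have yV : y \in V by apply: subsetP yx; apply: star_V.
apply/esym/eqP; rewrite eqEcard !(card_star pl) // leqnn andbT.
apply/subsetP => z zx; rewrite in_setU1; case: eqP => //= /eqP zy.
by apply: (cl x) => //; rewrite eq_sym.
Qed.

Definition deep := [set x in V | 1 < lack x].

(* A pair y, z of far points is covered by the star of y or of z unless both
   are deep.  If some far point of a deep point x were not covered, the stars
   through x would number at most [lack x - 1], and the [n - 1] or more
   uncovered points would all be deep. *)
Lemma decomposes_stars :
  clique_stars ->
  (forall x x' y z, x \in V -> x' \in V -> lack x = 1 -> lack x' = 1 ->
    y != z -> y \in star x -> z \in star x -> y \in star x' -> z \in star x' ->
    star x = star x') ->
  #|deep| < n ->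
  exists M, decomposes n V B M.
Proof.
move=> cl un dn; pose M := [set star x | x in [set x in V | lack x == 1]].
have MP m : m \in M -> exists2 x, x \in V /\ lack x = 1 & m = star x.
  case/imsetP => x; rewrite inE => /andP [xV /eqP dx] ->; by exists x.
have inM x : x \in V -> lack x = 1 -> star x \in M.
  by move=> xV dx; apply: imset_f; rewrite inE xV dx.
have starx x : x \in star x by rewrite in_setU1 eqxx.
have Mfar m x y : m \in M -> x \in m -> y \in m -> x != y -> y \in far x.
  by case/MP => w [wV dw] ->; apply: cl.
exists M; split=> //.
- by move=> m /MP [x [xV dx] ->]; rewrite star_V ?(card_star pl).
- move=> x y xV yx; pose P := [set m in M | x \in m].
  have [/exists_inP [m mP ym]|nc] := boolP [exists m in P, y \in m].
    by move: mP; rewrite inE => /andP [mM xm]; exists m.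
  pose Cov := [set u in far x | [exists m in P, u \in m]].
  have sC : Cov \subset far x by apply/subsetP => u /[!inE] /andP [].
  have cCov : #|Cov| = #|P| * n.-1.
    have := double_count P (far x).
    rewrite (eq_bigr (fun=> n.-1)) ?sum_nat_const; last first.
      move=> m /[!inE] /andP [mM xm].
      have -> : m :&: far x = m :\ x.
        apply/setP => u; rewrite [LHS]inE [RHS]inE in_set1 [RHS]andbC.
        case um: (u \in m) => //=; apply/idP/idP => [/far_neq //|ux].
        by apply: (Mfar m) => //; rewrite eq_sym.
      have [w [wV dw] mE] := MP _ mM.
      by rewrite -(card_star pl wV dw) -mE (cardsD1 x m) xm.
    move=> ->; rewrite (eq_bigr (fun u => (u \in Cov) : nat)).
      by rewrite sum_mem_card (setIidPr sC).
    move=> u ux; rewrite inE ux /=; case: exists_inP => [[m mP um]|H].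
      apply/eqP/cards1P; exists m; apply/setP => c; rewrite !inE.
      move: mP; rewrite inE => /andP [mM xm].
      apply/idP/eqP => [/andP [/andP [cM xc] uc]|->]; last by rewrite mM xm um.
      have [v [vV dv] cE] := MP _ cM; have [w [wV dw] mE] := MP _ mM.
      rewrite cE mE; apply: (un v w u x) => //; rewrite -?cE -?mE //.
      exact: far_neq ux.
    apply/eqP; rewrite cards_eq0; apply/eqP/setP => c; rewrite in_set0.
    apply/negP => /[1!inE] /andP [cP uc]; apply: H; by exists c.
  have yC : y \notin Cov by rewrite inE (negbTE nc) andbF.
  have ltC : #|Cov| < #|far x|.
    apply: proper_card; apply/properP; split=> //; by exists y.
  have dx : 1 < lack x.
    have := far_lack pl xV yx; case dx: (lack x) => [|[|k]] // _; case/negP: nc.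
    apply/exists_inP; exists (star x); first by rewrite inE inM //= starx.
    by rewrite in_setU1 yx orbT.
  have sub : x |: (far x :\: Cov) \subset deep.
    apply/subsetP => u; rewrite in_setU1 => /orP [/eqP ->|/setDP [ux uC]].
      by rewrite inE xV dx.
    have uV := far_V ux; rewrite inE uV /=.
    have := far_lack_r pl xV ux; case du: (lack u) => [|[|k]] // _.
    case/negP: uC; rewrite inE ux /=; apply/exists_inP; exists (star u) => //.
    by rewrite inE inM //= in_setU1 far_sym ?orbT.
  have := subset_leq_card sub; rewrite cardsU1 cardsD (setIidPr sC).
  have -> : x \notin far x :\: Cov by rewrite !inE eqxx /= !andbF.
  move: ltC; rewrite (card_far pl xV) cCov ltn_pmul2r; last lia.
  move=> Pd; nia.
- move=> m m' x y /MP [w [wV dw] ->] /MP [w' [wV' dw'] ->].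
  exact: un.
Qed.

(** Of two common points of two stars one has lack 1, and by [star_eq] its star equals both. *)
Lemma decomposes_clique_stars : clique_stars -> #|deep| <= 1 ->
  exists M, decomposes n V B M.
Proof.
move=> cl dn; apply: decomposes_stars => //; last lia.
have key x x' y : x \in V -> x' \in V -> lack x = 1 -> lack x' = 1 ->
    y \in star x -> y \in star x' -> y \notin deep -> 0 < lack y ->
    star x = star x'.
  move=> xV xV' dx dx' yx yx'.
  have yV : y \in V by apply: subsetP yx; apply: star_V.
  rewrite inE yV /= -leqNgt => H1 H2; have dy : lack y = 1 by lia.
  by rewrite -(star_eq cl xV dx yx dy) (star_eq cl xV' dx' yx' dy).
move=> x x' y z xV xV' dx dx' yz yx zx yx' zx'.
have zy := cl _ _ _ xV dx yx zx yz.
have yV : y \in V by apply: subsetP yx; apply: star_V.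
have [yd|yd] := boolP (y \in deep); last first.
  by apply: (key x x' y) => //; apply: far_lack zy.
have [zd|zd] := boolP (z \in deep); last first.
  by apply: (key x x' z) => //; apply: far_lack_r zy.
by case/eqP: yz; apply: (card_le1_eqP dn).
Qed.

End Decomposition.

(* Bruck's bound on two transversals of a net of order n and degree k (here
   [J] is "joined by a line of the net"): if S and S' share x and y, then
   S :|: S' has at least n + k points and is disjoint from the points joined
   to x or y, of which there are at least 2k(n-1) - k(k-1). *)
Lemma transversal_uniq (X : finType) (V S S' : {set X}) (J : rel X)
    (n k : nat) (x y : X) :
  #|V| = n ^ 2 -> S \subset V -> S' \subset V -> #|S| = n -> #|S'| = n ->
  0 < n -> k <= n -> (n - k) ^ 2 < n ->
  x \in S -> x \in S' -> y \in S -> y \in S' ->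
  (forall z, z \in V -> k * n.-1 <= #|[set u in V | J z u]|) ->
  #|[set u in V | J x u && J y u]| <= k * k.-1 ->
  (forall u v, u \in S -> v \in S -> ~~ J u v) ->
  (forall u v, u \in S' -> v \in S' -> ~~ J u v) ->
  (forall z, z \in V -> z \notin S -> k <= #|[set u in S | J z u]|) ->
  S = S'.
Proof.
move=> cV sV sV' cS cS' n0 kn small xS xS' yS yS' J1 J2 JS JS' Jk.
apply/esym/eqP; rewrite eqEcard cS cS' leqnn andbT; apply/subsetP => z zS'.
apply/negPn/negP => zS.
pose A := [set u in V | J x u]; pose A' := [set u in V | J y u].
(* The point z of S' outside S has k neighbours in S, and none of them is in S'. *)
have le1 : k <= #|S :\: S'|.
  apply: leq_trans (Jk z (subsetP sV' _ zS') zS) (subset_leq_card _).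
  apply/subsetP => u /[!inE] /andP [uS zu]; rewrite uS andbT.
  by apply/negP => uS'; case/negP: (JS' z u zS' uS').
have cU : #|S :|: S'| = n + #|S :\: S'|.
  by have := subset_leq_card (subsetIl S S'); rewrite cardsU cardsD cS cS'; lia.
have AA : A :&: A' = [set u in V | J x u && J y u].
  by apply/setP => u; rewrite !inE; case: (u \in V).
have xV := subsetP sV _ xS; have yV := subsetP sV _ yS.
have dis : [disjoint S :|: S' & A :|: A'].
  rewrite -setI_eq0; apply/eqP/setP => u; rewrite !inE; apply/negP.
  case/andP => /orP [] uS /orP [] /andP [_]; apply/negP; by [apply: JS|apply: JS'].
have sub : (S :|: S') :|: (A :|: A') \subset V.
  rewrite !subUset sV sV' /=; apply/andP; split; apply/subsetP => u;
    by rewrite inE => /andP [].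
have := subset_leq_card sub; rewrite cardsU (disjoint_setI0 dis) cards0 subn0.
have := cardsUI A A'; rewrite AA cU cV.
have := J1 x xV; have := J1 y yV; rewrite -/A -/A'.
(* The count n + k + 2k(n - 1) - k(k - 1) <= n^2 simplifies to n <= (n - k)^2, against [small]. *)
have e1 : k * n.-1 + k = k * n by rewrite addnC -mulnS prednK.
have e2 : k * k.-1 + k = k ^ 2 by case: (k) => // j; rewrite addnC -mulnS mulnn.
have e3 : (n - k) ^ 2 + 2 * (n * k) = n ^ 2 + k ^ 2.
  by rewrite sqrnB // subnK // nat_Cauchy.
move: J2 le1 e1 e2 e3 small; rewrite (mulnC n k).
move: (k * n.-1) (k * k.-1) (k * n) (k ^ 2) (n ^ 2) ((n - k) ^ 2).
by clear; lia.
Qed.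

(** * Transitive parallelism *)

Section Transitive.
Variables (T : finType) (n : nat) (V : {set T}) (B : {set {set T}}).
Hypothesis pl : plane n V B.
Notation pencil := (pencil B).
Notation far := (far V B).
Notation star := (star V B).
Notation lack := (lack n B).
Notation misses := (misses B).
Notation pclass := (pclass B).
Notation deep := (deep n V B).
Notation clique_stars := (clique_stars n V B).

Let n1 : 1 < n := plane_order pl.

Hypothesis par_trans : forall b c d, b \in B -> c \in B -> d \in B ->
  parallel b c -> parallel c d -> parallel b d.

Lemma trans_misses x K : K \in B -> #|misses x K| <= 1.
Proof.
move=> KB; apply: card_le1_in => b c /missesP [bB xb bK] /missesP [cB xc cK].
apply: (parallel_eq (x := x)) => //; apply: (@par_trans b K c) => //; apply/parallelP.
  by right.
by right; rewrite disjoint_sym.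
Qed.

Lemma trans_clique_stars : clique_stars.
Proof. by apply: (clique_stars_misses pl) => x K _ KB _ _; apply: trans_misses. Qed.

Lemma trans_pclass b c : b \in B -> c \in B -> parallel b c -> pclass b = pclass c.
Proof.
move=> bB cB bc; apply/setP => d; rewrite !mem_pclass.
case dB: (d \in B) => //=; apply/idP/idP => H.
  by apply: (@par_trans c b d) => //; rewrite parallelC.
exact: (@par_trans b c d).
Qed.

(** [misses_far] yields a parallel and transitivity its uniqueness. Hence the lines through a full
    point represent all parallel classes, once each. *)
Lemma trans_full x L : x \in V -> lack x = 0 -> L \in B ->
  #|[set K in pencil x | parallel K L]| = 1.
Proof.
move=> xV dx LB; apply/eqP; rewrite eqn_leq; apply/andP; split.
  apply: card_le1_in => b c; rewrite !inE =>
    /andP [/andP [bB xb] bL] /andP [/andP [cB xc] cL].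
  apply: (parallel_eq (x := x)) => //; apply: (@par_trans b L c) => //.
  by rewrite parallelC.
rewrite card_gt0; apply/set0Pn; have [xL|xL] := boolP (x \in L).
  by exists L; rewrite !inE LB xL /parallel eqxx.
have := misses_far pl LB xV xL; rewrite dx add0n => E.
have : 0 < #|misses x L| by rewrite -E.
rewrite card_gt0 => /set0Pn [b /missesP [bB xb bL]]; exists b.
by rewrite !inE bB xb /parallel bL orbT.
Qed.

Variable e : nat.
Hypothesis card_e : #|B| + e = n ^ 2 + n.
Hypothesis small_e : e ^ 2 <= n.

Lemma small_lt : e < n.
Proof.
have : n * 2 <= n * n by rewrite leq_mul2l n1 orbT.
case: (ltnP e n) => // ne; have : n * n <= e ^ 2 by rewrite -mulnn leq_mul.
lia.
Qed.

Lemma full_point : exists2 w, w \in V & lack w = 0.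
Proof.
have [/exists_inP [w wV /eqP dw]|] := boolP [exists w in V, lack w == 0].
  by exists w.
move=> /exists_inPn H; have := sum_lack pl card_e.
have : \sum_(x in V) 1 <= \sum_(x in V) lack x.
  by apply: leq_sum => x xV; have := H x xV; rewrite lt0n.
rewrite sum1_card (plane_points pl) -mulnn => H1 H2.
have : n * e < n * n by rewrite ltn_pmul2l ?small_lt //; lia.
lia.
Qed.

(* With s_K the size of the parallel class of a line K through a point w of
   full valency, the number of parallel pairs is the sum of the s_K ^ 2, which
   convexity bounds from below. *)
Lemma sum_lack_sqr : \sum_(x in V) lack x ^ 2 <= n * e + e ^ 2.
Proof.
have [w wV dw] := full_point.
have cw : #|pencil w| = n.+1 by have := pencil_lack pl wV; rewrite dw addn0.
pose s K := #|pclass K|.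
have s1 : \sum_(K in pencil w) s K = #|B|.
  rewrite -sum1_card (double_count_rel (pencil w) B (fun b c => parallel b c)).
  by apply: eq_bigr => L LB; rewrite trans_full.
have s2 : \sum_(L in B) s L = \sum_(K in pencil w) s K ^ 2.
  transitivity (\sum_(K in pencil w) \sum_(L in B) (parallel K L) * s L).
    rewrite exchange_big; apply: eq_bigr => L LB; rewrite -big_distrl /=.
    transitivity (#|[set K in pencil w | parallel K L]| * s L).
      by rewrite trans_full ?mul1n.
    congr (_ * _); rewrite -sum1_card big_mkcond [RHS]big_mkcond.
    by apply: eq_bigr => K _; rewrite !inE; case: (K \in B); case: (w \in K); case:
      parallel.
  apply: eq_bigr => K /[1!inE] /andP [KB wK].
  rewrite -mulnn {1}(_ : s K = \sum_(L in pclass K) 1); last by rewrite sum1_card.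
  rewrite big_distrl /= big_mkcond [RHS]big_mkcond.
  apply: eq_bigr => L _; rewrite inE; case LB: (L \in B) => //=.
  by case KL: (parallel K L); rewrite ?mul0n // /s (trans_pclass KB LB KL).
have s3 : \sum_(L in B) (s L + n ^ 2) = \sum_(L in B) (#|B| + \sum_(x in L) lack x).
  by apply: eq_bigr => L LB; exact: (card_pclass pl LB).
have s4 : \sum_(L in B) \sum_(x in L) lack x + \sum_(x in V) lack x ^ 2 = n * e * n.+1.
  transitivity (\sum_(x in V) lack x * (#|pencil x| + lack x)); last first.
    rewrite -(sum_lack pl card_e) big_distrl; apply: eq_bigr => x xV.
    by rewrite (pencil_lack pl xV).
  under [RHS]eq_bigr => x _ do rewrite mulnDr mulnn.
  rewrite big_split /=; congr (_ + _).
  transitivity (\sum_(L in B) \sum_(x in V) (x \in L) * lack x).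
    apply: eq_bigr => L LB; rewrite big_mkcond [RHS]big_mkcond; apply: eq_bigr => x _.
    case xL: (x \in L); first by rewrite (line_V pl LB xL) mul1n.
    by case: (x \in V).
  rewrite exchange_big; apply: eq_bigr => x xV; rewrite -big_distrl /= mulnC.
  congr (_ * _); rewrite -sum1_card big_mkcond [RHS]big_mkcond.
  by apply: eq_bigr => L _; rewrite inE; case: (L \in B); case: (x \in L).
(* This is 2ns <= s^2 + n^2 for each of the n + 1 classes; the expected class size is n. *)
have s5 : 2 * n * #|B| <= \sum_(K in pencil w) s K ^ 2 + n.+1 * n ^ 2.
  rewrite -s1 big_distrr -cw -sum_nat_const -big_split; apply: leq_sum => K _ /=.
  by rewrite -mulnA addnC nat_Cauchy.
move: s3; rewrite !big_split /= s2 !sum_nat_const.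
move: s4 s5 card_e; move:
  (\sum_(L in B) \sum_(x in L) lack x) (\sum_(x in V) lack x ^ 2).
move: (\sum_(K in pencil w) s K ^ 2) (#|B|).
rewrite -!mulnn; clear; move=> S b D1 D2.
have h1 : (b + e) * b = b * (b + e) by lia.
move=> H1 H2 H3 H4; move: h1; rewrite {2}H3.
have h2 : (b + e) * e = (n * n + n) * e by rewrite H3.
have h3 : (b + e) * n = (n * n + n) * n by rewrite H3.
move: H1 H2 H3 H4 h2 h3; rewrite !mulnDl !mulnDr !mulSn !mulnA.
lia.
Qed.

(** At a deep point the square of the lack exceeds the lack by at least 2, so 2 |[deep]| <= e^2 <=
    n. *)
Lemma card_deep : #|deep| < n.
Proof.
have : \sum_(x in V) lack x + 2 * #|deep| <= n * e + e ^ 2.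
  apply: leq_trans sum_lack_sqr; have -> : deep = V :&: deep.
    by apply/esym/setIidPr/subsetP => x; rewrite inE => /andP [].
  rewrite -sum_mem_card big_distrr -big_split; apply: leq_sum => x xV /=.
  rewrite inE xV /= -mulnn; case: (lack x) => [|[|d]] //=; rewrite mul2n.
  rewrite mulSn; lia.
rewrite (sum_lack pl card_e); have := n1; have := small_e; lia.
Qed.

(** If x is outside [star x'], two points of that star are far from x, so at least two of the n
    lines through x miss the star. By [misses_far] such a line meets every line through x'. With the
    n lines through x' this gives n + 2 pairwise non-parallel lines, but a full point w allows only
    n + 1 parallel classes. *)
Lemma trans_star_uniq x x' y z : x \in V -> x' \in V -> lack x = 1 -> lack x' = 1 ->
  y != z -> y \in star x -> z \in star x -> y \in star x' -> z \in star x' ->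
  star x = star x'.
Proof.
move=> xV xV' dx dx' yz yx zx yx' zx'; have cl := trans_clique_stars.
have [xx'|xx'] := boolP (x \in star x'); first exact: (star_eq pl cl xV' dx' xx' dx).
exfalso.
have nx u : u \in star x -> u \in star x' -> u \in far x.
  rewrite in_setU1 => /orP [/eqP -> |//]; by rewrite (negbTE xx').
pose F := [set b in pencil x | [disjoint b & star x']].
have F2 : 1 < #|F|.
  have := card_joined_pencil pl xx' xV (star_V B xV'); rewrite (card_star pl) //.
  have : 1 < #|star x' :&: far x|.
    apply/card_gt1P; exists y, z; split=> //; rewrite in_setI ?yx' ?zx' /=; exact: nx.
  have : \sum_(b in pencil x) 1 <= \sum_(b in pencil x) #|b :&: star x'| + #|F|.
    have -> : F = pencil x :&: F.
      by apply/esym/setIidPr/subsetP => b; rewrite inE => /andP [].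
    rewrite -sum_mem_card -big_split; apply: leq_sum => b bx /=.
    rewrite inE bx /= -setI_eq0 -cards_eq0; by case: #|_|.
  rewrite sum1_card; have := pencil_lack pl xV; rewrite dx; lia.
have [K1 [K2 [K1F K2F K12]]] := card_gt1_ex F2.
have FP K : K \in F -> [/\ K \in B, x \in K & [disjoint K & star x'] ].
  by rewrite !inE -andbA => /and3P.
have Fnp K b : K \in F -> b \in pencil x' -> ~~ parallel b K.
  move=> /FP [KB xK dK] /[1!inE] /andP [bB xb]; apply/negP => bK.
  have xK' : x' \notin K.
    by apply/negP => xK'; apply: (disjointF dK xK'); rewrite in_setU1 eqxx.
  have := misses_far pl KB xV' xK'; rewrite dx'.
  have -> : K :&: far x' = set0.
    apply/setP => u; rewrite in_setI in_set0; apply/negP => /andP [uK ux'].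
    by apply: (disjointF dK uK); rewrite in_setU1 ux' orbT.
  rewrite cards0 => /eqP; rewrite eq_sym -[X in _ == X]addn0 eqn_add2l cards_eq0.
  move=> /eqP E; have := in_set0 b; rewrite -E => /negbT/missesP; apply; split=> //.
  by case/parallelP: bK => // bK; rewrite -bK xb in xK'.
have [w wV dw] := full_point.
have [K1B xK1 dK1] := FP _ K1F; have [K2B xK2 dK2] := FP _ K2F.
pose Q := K1 |: (K2 |: pencil x').
have QB b : b \in Q -> b \in B.
  by rewrite !in_setU1 => /or3P [/eqP ->|/eqP ->|] //; rewrite inE => /andP [].
have cQ : #|Q| = n.+2.
  have H K : K \in F -> K \notin pencil x'.
    by move=> KF; apply/negP => /(Fnp _ _ KF); rewrite /parallel eqxx.
  rewrite !cardsU1 in_setU1 negb_or K12 !H //=.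
  by have := pencil_lack pl xV'; rewrite dx' addn1 => -[->].
have Qnp b c : b \in Q -> c \in Q -> parallel b c -> b = c.
  have K12' : ~~ parallel K1 K2.
    by apply/negP => H; case/eqP: K12; apply: (parallel_eq H xK1 xK2).
  have pen u v : u \in pencil x' -> v \in pencil x' -> parallel u v -> u = v.
    rewrite !inE => /andP [_ xu] /andP [_ xv] uv; exact: (parallel_eq uv xu xv).
  have H1 := Fnp K1 _ K1F; have H2 := Fnp K2 _ K2F.
  rewrite !in_setU1 => /or3P [/eqP ->|/eqP ->|bp] /or3P [/eqP ->|/eqP ->|cp] // H.
  - by rewrite H in K12'.
  - by case/negP: (H1 _ cp); rewrite parallelC.
  - by rewrite parallelC H in K12'.
  - by case/negP: (H2 _ cp); rewrite parallelC.
  - by case/negP: (H1 _ bp).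
  - by case/negP: (H2 _ bp).
  - exact: pen.
have := double_count_rel (pencil w) Q (fun b c => parallel b c).
rewrite [RHS](eq_bigr (fun=> 1)); last by move=> L /QB LB; rewrite trans_full.
rewrite sum1_card cQ => E.
have : \sum_(b in pencil w) #|[set c in Q | parallel b c]| <= \sum_(b in pencil w) 1.
  apply: leq_sum => b; rewrite inE => /andP [bB wb]; apply: card_le1_in => c d.
  rewrite ![_ \in [set _ in Q | _]]inE => /andP [cQ' bc] /andP [dQ' bd]; apply:
    Qnp => //.
  by apply: (@par_trans c b d) (QB _ cQ') bB (QB _ dQ') _ bd; rewrite parallelC.
by rewrite E sum1_card; have := pencil_lack pl wV; rewrite dw addn0 => ->; rewrite ltnn.
Qed.

Lemma trans_decomposes : exists M, decomposes n V B M.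
Proof.
apply: (decomposes_stars pl trans_clique_stars _ card_deep).
exact: trans_star_uniq.
Qed.

End Transitive.

(** * A line of points of full valency *)

Section FullLine.
Variables (T : finType) (n : nat) (V : {set T}) (B : {set {set T}}).
Hypothesis pl : plane n V B.
Notation pencil := (pencil B).
Notation far := (far V B).
Notation lack := (lack n B).
Notation misses := (misses B).
Notation pclass := (pclass B).
Notation deep := (deep n V B).

Let n1 : 1 < n := plane_order pl.

Variables (e : nat) (L0 : {set T}).
Hypothesis card_e : #|B| + e = n ^ 2 + n.
Hypothesis L0B : L0 \in B.
Hypothesis L0full : forall x, x \in L0 -> lack x = 0.

Lemma full_far (L : {set T}) x : x \in V -> (forall y, y \in L -> lack y = 0) ->
  L :&: far x = set0.
Proof.
move=> xV H; apply/setP => y; rewrite in_setI in_set0; apply/negP => /andP [yL yx].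
by have := far_lack_r pl xV yx; rewrite H.
Qed.

Lemma full_line_misses x : x \in V -> x \notin L0 -> lack x + #|misses x L0| = 1.
Proof.
by move=> xV xL; rewrite -(misses_far pl L0B xV xL) full_far ?cards0.
Qed.

Lemma full_line_lack x : x \in V -> lack x <= 1.
Proof.
move=> xV; have [/L0full ->//|xL] := boolP (x \in L0).
by rewrite -(full_line_misses xV xL) leq_addr.
Qed.

Notation P0 := (pclass L0).

Lemma P0B b : b \in P0 -> b \in B.
Proof. by rewrite mem_pclass => /andP []. Qed.

Lemma P0_full b x : b \in P0 -> x \in b -> lack x = 0.
Proof.
rewrite mem_pclass => /andP [bB /parallelP [<-|db]] xb; first exact: L0full.
have xL : x \notin L0 by apply/negP => xL; apply: (disjointF db xL xb).
have := full_line_misses (line_V pl bB xb) xL.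
suff : 0 < #|misses x L0| by clear; lia.
by rewrite card_gt0; apply/set0Pn; exists b; apply/missesP; rewrite disjoint_sym.
Qed.

Lemma P0_cover x : x \in V -> lack x = 0 -> #|[set b in P0 | x \in b]| = 1.
Proof.
move=> xV dx; have [xL|xL] := boolP (x \in L0).
  exact: pclass_at_in.
by rewrite pclass_at //; have := full_line_misses xV xL; rewrite dx.
Qed.

(** All points of L are full, so by [card_pclass] both classes have |B| - n^2 members. Two members
    of [P0] sharing a point would contradict [P0_cover], so [P0] is contained in [pclass L]. *)
Lemma P0_pclass L : L \in P0 -> pclass L = P0.
Proof.
have card_full K : K \in P0 -> #|pclass K| + n ^ 2 = #|B|.
  move=> KP; rewrite (card_pclass pl (P0B KP)) big1 ?addn0 // => x.
  exact: P0_full.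
move=> LP; apply/esym/eqP; rewrite eqEcard.
have LP0 : L0 \in P0 by rewrite mem_pclass L0B /parallel eqxx.
have -> /= : #|pclass L| <= #|P0|.
  by rewrite -(leq_add2r (n ^ 2)) !card_full.
rewrite andbT; apply/subsetP => b bP; rewrite mem_pclass P0B //=.
apply/negPn/negP => /not_parallel [Lb [x xL xb]].
have xV := line_V pl (P0B LP) xL.
have /eqP/cards1P [c E] := P0_cover xV (P0_full LP xL).
have : L \in [set c] by rewrite -E inE LP.
have : b \in [set c] by rewrite -E inE bP.
by rewrite !inE => /eqP bc /eqP Lc; rewrite bc Lc eqxx in Lb.
Qed.

Definition dual_degree := #|P0|.

Lemma dual_degree_e : dual_degree + e = n.
Proof.
have : dual_degree + n ^ 2 = #|B|.
  rewrite /dual_degree (card_pclass pl L0B) big1 ?addn0 // => x; exact: L0full.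
move: card_e; lia.
Qed.

Definition skew := B :\: P0.

Lemma skewB b : b \in skew -> b \in B.
Proof. by case/setDP. Qed.

Lemma skew_meet b L : b \in skew -> L \in P0 -> #|L :&: b| = 1.
Proof.
case/setDP => bB bP LP; have LB := P0B LP.
have : ~~ parallel L b by apply: contra bP => H; rewrite -(P0_pclass LP) mem_pclass bB.
move=> /not_parallel [Lb [x xL xb]]; rewrite (card_meet pl LB bB Lb).
by case: (boolP [disjoint L & b]) => // d; case: (disjointF d xL xb).
Qed.

Definition fullpts (b : {set T}) := [set p in b | lack p == 0].

Lemma card_fullpts b : b \in skew -> #|fullpts b| = dual_degree.
Proof.
move=> bs; have bB := skewB bs; have := double_count P0 b.
rewrite (eq_bigr (fun=> 1)); last by move=> L LP; apply: skew_meet.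
rewrite sum1_card => E; rewrite /dual_degree E.
rewrite (eq_bigr (fun x => (x \in fullpts b) : nat)).
  rewrite sum_mem_card; congr #|pred_of_set _|; apply/esym/setIidPr/subsetP => x.
  by rewrite inE => /andP [].
move=> x xb; rewrite inE xb /=; have xV := line_V pl bB xb.
case: eqP => [dx|dx]; first exact: P0_cover.
apply/eqP; rewrite cards_eq0; apply/eqP/setP => L; rewrite !in_set.
by apply/negP => /andP [LP xL]; apply: dx; apply: (P0_full (b := L));
  rewrite ?mem_pclass.
Qed.

Lemma card_skew : #|skew| = n ^ 2.
Proof.
have sub : P0 \subset B by apply/subsetP => b; apply: P0B.
have := dual_degree_e; have := subset_leq_card sub; move: card_e;
  rewrite /skew cardsD (setIidPr sub) -/dual_degree.
clear; lia.
Qed.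

Lemma card_skew_pencil p : p \in V -> lack p = 0 ->
  #|[set b in skew | p \in b]| = n.
Proof.
move=> pV dp; have := pencil_lack pl pV; rewrite dp addn0.
rewrite -(cardsID P0 (pencil p)).
have -> : pencil p :&: P0 = [set b in P0 | p \in b].
  by apply/setP => b; rewrite !inE; case: (b \in B); case: (p \in b);
    rewrite ?andbT ?andbF.
rewrite P0_cover // add1n => -[<-]; apply: eq_card => b; rewrite !inE.
by case: (b \in B); case: (p \in b); rewrite ?andbT ?andbF.
Qed.

(* Lines meeting in a point of full valency: this is the collinearity of a
   dual net of order n and degree [dual_degree] whose points are the lines of [skew]. *)
Definition crossing (b c : {set T}) :=
  (b != c) && [exists p in b, (lack p == 0) && (p \in c)].

Lemma crossingP (b c : {set T}) :
  reflect (b != c /\ exists p, [/\ p \in b, lack p = 0 & p \in c])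
  (crossing b c).
Proof.
apply: (iffP andP) => -[bc]; [move/exists_inP=> [p pb /andP [/eqP dp pc]]|case=>
  p [pb dp pc]].
  by split=> //; exists p.
by split=> //; apply/exists_inP; exists p => //; rewrite dp pc.
Qed.

Lemma skew_V p (b : {set T}) : b \in skew -> p \in b -> p \in V.
Proof. by move/skewB/(line_V pl); apply. Qed.

Lemma crossing_degree b :
  b \in skew -> dual_degree * n.-1 <= #|[set c in skew | crossing b c]|.
Proof.
move=> bs; have bB := skewB bs; have := double_count (skew :\ b) (fullpts b).
rewrite [X in _ = X](eq_bigr (fun=> n.-1)) ?sum_nat_const ?card_fullpts //; last first.
  move=> p; rewrite inE => /andP [pb /eqP dp].
  have bp : b \in [set c in skew | p \in c] by rewrite inE bs pb.
  rewrite -(card_skew_pencil (skew_V bs pb) dp) [#|[set c in skew | p \in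
    c]|](cardsD1 b) bp /=.
  by apply: eq_card => c; rewrite !inE -!andbA; case: (c != b).
move=> <-.
apply: (@leq_trans (\sum_(c in skew :\ b) (c \in [set c in skew | crossing b c] :
  nat))).
  apply: leq_sum => c /setD1P [cb cs]; rewrite inE cs /=; have cB := skewB cs.
  have le1 : #|c :&: fullpts b| <= 1.
    apply: leq_trans (_ : #|c :&: b| <= 1); last by rewrite (card_meet pl cB bB cb);
      case: disjoint.
    apply/subset_leq_card/setIS/subsetP => p; by rewrite inE => /andP [].
  case: crossingP => // H; rewrite leqn0 cards_eq0; apply/eqP/setP => p.
  rewrite in_setI in_set0 inE; apply/negP => /and3P [pc pb /eqP dp].
  by apply: H; split; [rewrite eq_sym|exists p].
by rewrite sum_mem_card; apply/subset_leq_card/subsetIr.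
Qed.

(** A line crossing b and c is determined by its full points p on b and q on c, and q is not on the
    member of [P0] through p: one of the full points of c is excluded. *)
Lemma crossing_common b c : b \in skew -> c \in skew -> [disjoint b & c] ->
  #|[set u in skew | crossing b u && crossing c u]| <= dual_degree * dual_degree.-1.
Proof.
move=> bs cs dbc; rewrite -{1}(card_fullpts bs) -sum_nat_const.
pose A p := [set u in skew | [&& p \in u, c != u & crossing c u]].
apply: (@leq_trans (\sum_(p in fullpts b) #|A p|)).
  rewrite -sum1_card /A.
  have -> : \sum_(p in fullpts b) #|A p| =
      \sum_(u in skew) #|[set p in fullpts b | [&& p \in u, c != u & crossing c u]]|.
    exact: double_count_rel.
  rewrite big_mkcond [X in _ <= X]big_mkcond; apply: leq_sum => u _.
  case: ifP => //; rewrite inE => /andP [-> /andP [/crossingP [bu [p [pb dp pu]]] cu]].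
  rewrite card_gt0; apply/set0Pn; exists p; rewrite !inE pb dp pu cu eqxx /= andbT.
  by case/andP: cu.
apply: leq_sum => p; rewrite inE => /andP [pb /eqP dp].
have pV := skew_V bs pb.
have /eqP/cards1P [L E] := P0_cover pV dp.
have : L \in [set L] by rewrite inE.
rewrite -E inE => /andP [LP pL]; have LB := P0B LP.
have cLc : #|fullpts c :\: L| = dual_degree.-1.
  rewrite cardsD card_fullpts // (_ : fullpts c :&: L = L :&: c) ?skew_meet ?subn1 //.
  apply/setP => q; rewrite !in_setI inE andbC; case qL: (q \in L) => //=.
  by rewrite (P0_full LP qL) eqxx andbT.
rewrite -cLc; apply: (card_le_rel (r := fun (u : {set T}) q => q \in u)).
  move=> u; rewrite inE => /and4P [us pu _ /crossingP [cu [q [qc dq qu]]]];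
    exists q => //.
  rewrite !inE qc dq eqxx !andbT; apply/negP => qL.
  have pq : p != q by apply/eqP => pq; apply: (disjointF dbc pb); rewrite pq.
  have uL := line_uniq pl (skewB us) LB pq pu qu pL qL.
  by case/setDP: us => _; rewrite uL LP.
move=> u u' q; rewrite !inE => /andP [/andP [_ uB] /andP [pu _]].
move=> /andP [/andP [_ uB'] /andP [pu' _]] /andP [qL _] qu qu'.
by apply: (line_uniq pl uB uB' _ pu qu pu' qu'); apply: contraNneq qL => <-.
Qed.

Lemma skew_pclass_sub b : b \in skew -> pclass b \subset skew.
Proof.
move=> bs; apply/subsetP => c; rewrite mem_pclass => /andP [cB bc].
rewrite inE cB andbT; apply/negP => cP; case/setDP: bs => bB; case/negP.
by rewrite -(P0_pclass cP) mem_pclass bB parallelC.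
Qed.

(** Of the n points of b, n - e are full and e have lack 1, so [card_pclass] gives (n - e) + e. *)
Lemma skew_card_pclass b : b \in skew -> #|pclass b| = n.
Proof.
move=> bs; have bB := skewB bs; have := card_pclass pl bB.
have : \sum_(x in b) lack x + #|fullpts b| = n.
  rewrite -[RHS](line_card pl bB) -[RHS]sum1_card.
  rewrite -(setIidPr (_ : fullpts b \subset b)); last first.
    by apply/subsetP => p; rewrite inE => /andP [].
  rewrite -sum_mem_card -big_split; apply: eq_bigr => x xb /=.
  have := full_line_lack (skew_V bs xb); rewrite inE xb /=.
  by case: (lack x) => [|[|]].
rewrite card_fullpts //; have := dual_degree_e; move: card_e; clear; lia.
Qed.

Lemma full_misses p (b : {set T}) : b \in B -> p \in V -> lack p = 0 -> p \notin b ->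
  #|misses p b| = 1.
Proof.
move=> bB pV dp pb; have := misses_far pl bB pV pb; rewrite dp add0n => <-.
have -> : b :&: far p = set0; last by rewrite cards0.
apply/setP => q; rewrite in_setI in_set0; apply/negP => /andP [_ qp].
by have := far_lack pl pV qp; rewrite dp.
Qed.

Lemma full_pclass_uniq (b c d : {set T}) p :
  b \in B -> c \in pclass b -> d \in pclass b ->
  lack p = 0 -> p \in c -> p \in d -> c = d.
Proof.
rewrite !mem_pclass => bB /andP [cB bc] /andP [dB bd] dp pc pd.
have pV := line_V pl cB pc; have [pb|pb] := boolP (p \in b).
  by rewrite -(parallel_eq bc pb pc) (parallel_eq bd pb pd).
have mis u : u \in B -> parallel b u -> p \in u -> u \in misses p b.
  move=> uB bu pu; apply/missesP; split=> //; rewrite disjoint_sym.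
  by case/parallelP: bu => // bu; rewrite bu pu in pb.
have le1 : #|misses p b| <= 1 by rewrite full_misses.
by apply: (card_le1_eqP le1); apply: mis.
Qed.

Hypothesis small_e : e ^ 2 < n.

(** Both classes are transversals of the dual net and contain b and c: each has n lines, no two of
    them sharing a full point. The degree is n - e, so Bruck's condition is [small_e]. *)
Lemma skew_trans b c : b \in skew -> parallel b c -> c \in B -> pclass b = pclass c.
Proof.
move=> bs bc cB; have bB := skewB bs.
have [<-//|nbc] := eqVneq b c.
have dbc : [disjoint b & c] by case/parallelP: bc => // /eqP; rewrite (negbTE nbc).
have cb : c \in pclass b by rewrite mem_pclass cB.
have cs := subsetP (skew_pclass_sub bs) _ cb.
have noJ u S : u \in B -> S = pclass u -> forall v w, v \in S -> w \in S -> ~~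
  crossing v w.
  move=> uB -> v w vS wS; apply/negP => /crossingP [vw [p [pv dp pw]]].
  by case/eqP: vw; apply: (full_pclass_uniq uB vS wS dp).
have kn := dual_degree_e.
apply: (@transversal_uniq _ skew (pclass b) (pclass c) crossing n dual_degree b c) =>
  //.
- exact: card_skew.
- exact: skew_pclass_sub.
- exact: skew_pclass_sub.
- exact: skew_card_pclass.
- exact: skew_card_pclass.
- exact: ltnW.
- by rewrite -kn leq_addr.
- by rewrite -{1}kn addKn.
- by rewrite mem_pclass bB /parallel eqxx.
- by rewrite mem_pclass bB parallelC.
- by rewrite mem_pclass cB /parallel eqxx.
- exact: crossing_degree.
- exact: crossing_common.
- exact: noJ bB _.
- exact: noJ cB _.
(* Each full point of z lies on exactly one parallel of b, and different points give different
   parallels, since z shares at most one point with another line. *)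
- move=> z zs zb; rewrite -(card_fullpts zs).
  apply: (card_le_rel (r := fun p (u : {set T}) => p \in u)).
    move=> p; rewrite inE => /andP [pz /eqP dp]; have pV := skew_V zs pz.
    have found u : u \in pclass b -> p \in u ->
        exists2 u, u \in [set u in pclass b | crossing z u] & p \in u.
      move=> ub pu; exists u => //; rewrite inE ub /=; apply/crossingP; split;
        last by exists p.
      by apply: contraNneq zb => ->.
    have [pb|pb] := boolP (p \in b).
      by apply: (found b) => //; rewrite mem_pclass bB /parallel eqxx.
    have /eqP/cards1P [u E] := full_misses bB pV dp pb.
    have : u \in misses p b by rewrite E inE.
    move=> /missesP [uB pu ub]; apply: (found u) => //.
    by rewrite mem_pclass uB /parallel disjoint_sym ub orbT.
  move=> p q u; rewrite !inE => /andP [pz _] /andP [qz _] /andP [/andP [uB _]].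
  move=> /andP [zu _] pu qu; apply/eqP/negPn/negP => pq; case/eqP: zu.
  exact: (line_uniq pl (skewB zs) uB pq).
Qed.

Lemma full_line_decomposes : exists M, decomposes n V B M.
Proof.
have deep0 : #|deep| <= 1.
  suff -> : deep = set0 by rewrite cards0.
  apply/setP => x; rewrite !inE; apply/negP => /andP [xV].
  by rewrite ltnNge full_line_lack.
apply: (decomposes_clique_stars pl _ deep0).
apply: (clique_stars_misses pl) => x K xV KB dx xK.
have [KP|KP] := boolP (K \in P0).
  have := misses_far pl KB xV xK.
  rewrite full_far // => [|y]; last exact: P0_full.
  by rewrite cards0 dx add1n => -[<-].
have Ks : K \in skew by rewrite in_setD KP KB.
apply: card_le1_in => b c /missesP [bB xb bK] /missesP [cB xc cK].
have Kb : parallel K b by rewrite /parallel disjoint_sym bK orbT.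
have : c \in pclass K by rewrite mem_pclass cB /parallel disjoint_sym cK orbT.
rewrite (skew_trans Ks Kb bB) mem_pclass => /andP [_ bc].
exact: (parallel_eq bc xb xc).
Qed.

End FullLine.

(** * Missing lines through a common point *)

Section Concurrent.
Variables (T : finType) (n : nat) (V : {set T}) (B : {set {set T}}).
Hypothesis pl : plane n V B.
Notation pencil := (pencil B).
Notation far := (far V B).
Notation star := (star V B).
Notation lack := (lack n B).
Notation misses := (misses B).
Notation pclass := (pclass B).
Notation deep := (deep n V B).
Notation clique_stars := (clique_stars n V B).

Let n1 : 1 < n := plane_order pl.

Variables (e : nat) (Q : T).
Hypothesis card_e : #|B| + e = n ^ 2 + n.
Hypothesis QV : Q \in V.
Hypothesis lackQ : lack Q = e.

(** The obvious lower bounds, e at Q and 1 at each of the e(n - 1) points far from Q, already add up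
    to the total n * e, so all of them are attained. *)
Lemma concurrent_lack x : x \in V -> x != Q -> lack x = (x \in far Q).
Proof.
pose g x := if x == Q then e else (x \in far Q : nat).
have gle x' : x' \in V -> g x' <= lack x' ?= iff (g x' == lack x').
  move=> xV; split=> //; rewrite /g; case: eqP => [->|_]; first by rewrite lackQ.
  by case xQ: (x' \in far Q) => //; apply: far_lack_r xQ.
have [_ /esym] := leqif_sum gle.
have gQ : g Q = e by rewrite /g eqxx.
rewrite (sum_lack pl card_e) (bigD1 Q) //= gQ.
rewrite (eq_bigr (fun x => x \in far Q : nat)); last first.
  by move=> y /andP [_]; rewrite /g => /negbTE ->.
have -> : \sum_(i in V | i != Q) (i \in far Q) = #|far Q|.
  transitivity #|(V :\ Q) :&: far Q|.
    by rewrite -sum_mem_card; apply: eq_bigl => y; rewrite in_setD1 andbC.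
  congr #|pred_of_set _|; apply/setIidPr/subsetP => y yQ.
  by rewrite in_setD1 (far_V yQ) (far_neq yQ).
rewrite (card_far pl QV) lackQ -mulnS prednK ?(ltnW n1) // mulnC eqxx.
move=> /forall_inP H xV xQ; have /eqP <- := H x xV.
by rewrite /g (negbTE xQ).
Qed.

Lemma pencilQ_B M : M \in pencil Q -> M \in B.
Proof. by rewrite inE => /andP []. Qed.

Lemma pencilQ_full M x : M \in pencil Q -> x \in M -> x != Q -> lack x = 0.
Proof.
rewrite inE => /andP [MB QM] xM xQ; rewrite concurrent_lack ?(line_V pl MB xM) //.
by case xf: (x \in far Q) => //; case: (far_line xf MB QM xM).
Qed.

(** Only Q can be a point of M far from x, and it is far exactly when [lack x] = 1; so the two sides
    of [misses_far] balance. *)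
Lemma pencilQ_misses M x : M \in pencil Q -> x \in V -> x \notin M ->
  #|misses x M| = 1.
Proof.
move=> MQ xV xM; have MB := pencilQ_B MQ.
have QM : Q \in M by move: MQ; rewrite inE => /andP [].
have xQ : x != Q by apply: contraNneq xM => ->.
suff E : #|M :&: far x| = lack x.
  by have := misses_far pl MB xV xM; rewrite E; lia.
have sub y : y \in M :&: far x -> y = Q.
  rewrite in_setI => /andP [yM yx]; apply/eqP/negPn/negP => yQ.
  by have := far_lack_r pl xV yx; rewrite (pencilQ_full MQ yM yQ).
rewrite concurrent_lack //; case xf: (x \in far Q).
  apply/eqP/cards1P; exists Q; apply/setP => y; rewrite in_set1.
  apply/idP/eqP => [/sub //|->]; by rewrite in_setI QM far_sym.
apply/eqP; rewrite cards_eq0; apply/eqP/setP => y; rewrite in_set0.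
apply/negP => ym; move: (ym); rewrite (sub _ ym) in_setI => /andP [_ Qx].
by rewrite (far_sym xV Qx) in xf.
Qed.

Lemma pencilQ_cover M x : M \in pencil Q -> x \in V ->
  #|[set b in pclass M | x \in b]| = 1.
Proof.
move=> MQ xV; have MB := pencilQ_B MQ; have [xM|xM] := boolP (x \in M).
  exact: pclass_at_in.
by rewrite pclass_at // pencilQ_misses.
Qed.

Lemma pencilQ_uniq M x b c : M \in pencil Q -> b \in pclass M -> c \in pclass M ->
  x \in b -> x \in c -> b = c.
Proof.
move=> MQ bM cM xb xc.
have bB : b \in B by move: bM; rewrite mem_pclass => /andP [].
have le1 : #|[set b in pclass M | x \in b]| <= 1.
  by rewrite pencilQ_cover // (line_V pl bB xb).
by apply: (card_le1_eqP le1); rewrite inE ?xb ?xc ?bM ?cM.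
Qed.

Lemma pencilQ_class M : M \in pencil Q -> #|pclass M| = n.
Proof.
move=> MQ; have := double_count (pclass M) V.
rewrite [X in _ = X](eq_bigr (fun=> 1)); last by move=> x xV; apply: pencilQ_cover.
rewrite sum1_card (plane_points pl) (eq_bigr (fun=> n)).
  rewrite sum_nat_const -mulnn => /eqP; rewrite eqn_pmul2r; last lia.
  by move/eqP.
by move=> b /[1!mem_pclass] /andP [bB _];
  rewrite (setIidPl (line_sub pl bB)) (line_card pl bB).
Qed.

(** The n points of b lie on n different members of [pclass M], hence on all of them. *)
Lemma pencilQ_meet M b c : M \in pencil Q -> b \in B -> b \notin pclass M ->
  c \in pclass M -> ~~ [disjoint c & b].
Proof.
move=> MQ bB bM cM; apply/negP => dcb.
have : #|b| <= #|pclass M :\ c|.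
  apply: (card_le_rel (r := fun x (d : {set T}) => x \in d)).
    move=> x xb; have /eqP/cards1P [d E] := pencilQ_cover MQ (line_V pl bB xb).
    have : d \in [set b in pclass M | x \in b] by rewrite E inE.
    rewrite inE => /andP [dM xd]; exists d => //; rewrite in_setD1 dM andbT.
    by apply/eqP => dc; apply: (disjointF dcb _ xb); rewrite -dc.
  move=> x y d xb yb; rewrite in_setD1 => /andP [_ dM] xd yd.
  apply/eqP/negPn/negP => xy; case/negP: bM.
  have dB : d \in B by move: dM; rewrite mem_pclass => /andP [].
  by rewrite (line_uniq pl bB dB xy xb yb xd yd).
have := cardsD1 c (pclass M); rewrite cM (pencilQ_class MQ) (line_card pl bB).
by clear; lia.
Qed.

Lemma pencilQ_disjoint M M' b : M \in pencil Q -> M' \in pencil Q ->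
  b \in pclass M -> b \in pclass M' -> M = M'.
Proof.
move=> MQ MQ' bM bM'; apply/eqP/negPn/negP => MM'.
have MB' := pencilQ_B MQ'.
have nM : M' \notin pclass M.
  apply/negP; rewrite mem_pclass => /andP [_ H]; case/eqP: MM'.
  by move: MQ MQ'; rewrite !inE => /andP [_ QM] /andP [_ QM']; apply:
    parallel_eq H QM QM'.
have /negP := pencilQ_meet MQ MB' nM bM; apply.
move: bM'; rewrite mem_pclass => /andP [bB /parallelP [E|]];
  last by rewrite disjoint_sym.
by move: nM; rewrite E bM.
Qed.

(** The classes of the lines through Q partition V, and lines of different classes meet: a net of
    order n and degree n + 1 - e. *)
Definition net := [set b in B | [exists M in pencil Q, parallel M b]].

Lemma netP b : reflect (exists2 M, M \in pencil Q & b \in pclass M) (b \in net).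
Proof.
rewrite inE; apply: (iffP andP) => [[bB /exists_inP [M MQ Mb]]|[M MQ]].
  by exists M => //; rewrite mem_pclass bB.
by rewrite mem_pclass => /andP [-> Mb]; split=> //; apply/exists_inP; exists M.
Qed.

Lemma netB b : b \in net -> b \in B.
Proof. by rewrite inE => /andP []. Qed.

Definition net_deg := #|pencil Q|.

Lemma net_deg_e : net_deg + e = n.+1.
Proof. by rewrite -lackQ; exact: (pencil_lack pl QV). Qed.

Definition net_pencil x := [set b in net | x \in b].

Lemma card_net_pencil x : x \in V -> #|net_pencil x| = net_deg.
Proof.
move=> xV; have := double_count_rel (pencil Q) (pencil x) (fun b c => parallel b c).
rewrite (eq_bigr (fun=> 1)); last first.
  move=> M MQ; rewrite -(pencilQ_cover MQ xV); apply: eq_card => b.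
  by rewrite !inE andbAC.
rewrite sum1_card -/net_deg => ->.
rewrite [RHS](eq_bigr (fun b => (b \in net) : nat)).
  rewrite sum_mem_card; apply: eq_card => b;
    rewrite in_setI [in LHS]inE [b \in pencil x]inE.
  by case bn: (b \in net); rewrite ?andbF ?andbT //= (netB bn).
move=> b /[1!inE] /andP [bB xb]; case: netP => [[M MQ bM]|H].
  apply/eqP/cards1P; exists M; apply/setP => M'; rewrite [LHS]inE [RHS]inE.
  apply/idP/eqP => [/andP [MQ' M'b]|->].
    by apply: (@pencilQ_disjoint _ _ b) => //; rewrite mem_pclass bB.
  by rewrite MQ; move: bM; rewrite mem_pclass => /andP [].
apply/eqP; rewrite cards_eq0; apply/eqP/setP => M; rewrite in_set0 inE.
by apply/negP => /andP [MQ Mb]; apply: H; exists M; rewrite ?mem_pclass ?bB.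
Qed.

(** Unlike [joined] this is irreflexive: [transversal_uniq] forbids J u v inside a transversal even
    for u = v. *)
Definition net_joined x y := (x != y) && [exists b in net, (x \in b) && (y \in b)].

Lemma net_joinedP x y : reflect (x != y /\ exists b, [/\ b \in net, x \in b & y \in b])
  (net_joined x y).
Proof.
apply: (iffP andP) => -[xy]; [move/exists_inP=> [b bn /andP [xb yb]]|case=>
  b [bn xb yb]].
  by split=> //; exists b.
by split=> //; apply/exists_inP; exists b => //; rewrite xb yb.
Qed.

Lemma net_degree x : x \in V -> net_deg * n.-1 <= #|[set u in V | net_joined x u]|.
Proof.
move=> xV; have := double_count (net_pencil x) (V :\ x).
rewrite (eq_bigr (fun=> n.-1)) ?sum_nat_const ?card_net_pencil //; last first.
  move=> b /[1!inE] /andP [/netB bB xb].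
  rewrite -(line_card pl bB) (cardsD1 x b) xb; apply: eq_card => u; rewrite !inE.
  by case ub: (u \in b); rewrite ?andbF // (line_V pl bB ub) andbT.
move=> ->.
apply: (@leq_trans (\sum_(u in V :\ x) (u \in [set u in V | net_joined x u] : nat))).
  apply: leq_sum => u /setD1P [ux uV]; rewrite inE uV /=.
  case: net_joinedP => H.
    apply: card_le1_in => b c; rewrite !inE -!andbA.
    move=> /and4P [bB _ xb ub] /and4P [cB _ xc uc].
    by apply: (line_uniq pl bB cB _ xb ub xc uc); rewrite eq_sym.
  rewrite leqn0 cards_eq0; apply/eqP/setP => b; rewrite in_set0 in_set.
  apply/negP => /andP [bx ub]; apply: H; split; first by rewrite eq_sym.
  by exists b; move: bx; rewrite in_set => /andP [].
by rewrite sum_mem_card; apply/subset_leq_card/subsetIr.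
Qed.

(** A common neighbour is determined by a net line b through x and a net line through y. The latter
    is not in the class of b, since no line joins x and y. *)
Lemma net_common x y : x \in V -> y \in far x ->
  #|[set u in V | net_joined x u && net_joined y u]| <= net_deg * net_deg.-1.
Proof.
move=> xV yx; have yV := far_V yx.
rewrite -{1}(card_net_pencil xV) -sum_nat_const.
apply: (@leq_trans (\sum_(b in net_pencil x)
    #|[set u in V | (u \in b) && (net_joined y u)]|)).
  rewrite double_count_rel -sum1_card big_mkcond [X in _ <= X]big_mkcond.
  apply: leq_sum => u _; case: ifP => //; rewrite inE.
  move=> /andP [-> /andP [/net_joinedP [xu [b [bn xb ub]]] yu]].
  by rewrite card_gt0; apply/set0Pn; exists b;
    rewrite in_set ub yu [b \in _]in_set bn xb.
apply: leq_sum => b; rewrite in_set => /andP [bn xb].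
have [M MQ bM] := netP _ bn.
have cy : #|net_pencil y :\: pclass M| = net_deg.-1.
  rewrite cardsD card_net_pencil // (_ : _ :&: _ = [set b in pclass M | y \in b]).
    by rewrite pencilQ_cover // subn1.
  apply/setP => c; rewrite in_setI !in_set -andbA andbC -!andbA.
  case cB: (c \in B) => //=; case yc: (y \in c); rewrite ?andbF //=.
  case Mc: (parallel M c); rewrite ?andbF ?andbT //=.
  by apply/exists_inP; exists M.
rewrite -cy; apply: (card_le_rel (r := fun u (c : {set T}) => u \in c)).
  move=> u; rewrite in_set => /and3P [uV ub /net_joinedP [yu [c [cn yc uc]]]].
  exists c => //; rewrite in_setD [c \in net_pencil y]in_set cn yc !andbT;
    apply/negP => cM.
  have E := pencilQ_uniq MQ bM cM ub uc.
  by apply: (far_line yx (netB bn) xb); rewrite E.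
move=> u u' c; rewrite [u \in _]in_set [u' \in _]in_set in_setD.
move=> /and3P [_ ub _] /and3P [_ ub' _] /andP [cM]; rewrite in_set =>
  /andP [cn _] uc uc'.
apply/eqP/negPn/negP => uu; case/negP: cM.
by rewrite -(line_uniq pl (netB bn) (netB cn) uu ub ub' uc uc').
Qed.

(** For x off b, exactly one line through x misses b, so by [misses_far] exactly one point of b is
    far from x. Thus [star x] is a transversal of the net. *)
Lemma net_star b x : b \in net -> x \in V -> lack x = 1 -> x != Q ->
  #|b :&: star x| = 1.
Proof.
move=> bn xV dx xQ; have [M MQ bM] := netP _ bn; have bB := netB bn.
have [xb|xb] := boolP (x \in b).
  apply/eqP/cards1P; exists x; apply/setP => u; rewrite in_setI in_setU1 in_set1.
  case: eqP => [->|_]; first by rewrite xb.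
  by apply/andP => -[ub ux]; apply: (far_line ux bB xb ub).
have -> : b :&: star x = b :&: far x.
  apply/setP => u; rewrite !in_setI in_setU1; case: eqP => //= ->.
  by rewrite (negbTE xb).
have := misses_far pl bB xV xb; rewrite dx.
suff -> : #|misses x b| = 1 by lia.
rewrite -(pencilQ_cover MQ xV); apply: eq_card => c; rewrite in_set.
apply/missesP/andP => [[cB xc dcb]|[cM xc]].
  split=> //; apply/negPn/negP => cM.
  by case/negP: (pencilQ_meet MQ cB cM bM); rewrite disjoint_sym.
have cB : c \in B by move: cM; rewrite mem_pclass => /andP [].
split=> //; rewrite -setI_eq0; apply/eqP/setP => u; rewrite in_setI in_set0.
apply/negP => /andP [uc ub]; case/negP: xb.
by rewrite (pencilQ_uniq MQ bM cM ub uc).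
Qed.

Lemma net_star_free x u v : x \in V -> lack x = 1 -> x != Q ->
  u \in star x -> v \in star x -> ~~ net_joined u v.
Proof.
move=> xV dx xQ ux vx; apply/negP => /net_joinedP [uv [b [bn ub vb]]].
have le1 : #|b :&: star x| <= 1 by rewrite net_star.
by case/eqP: uv; apply: (card_le1_eqP le1); rewrite in_setI ?ub ?vb.
Qed.

Hypothesis small_e : e.-1 ^ 2 < n.

Lemma concurrent_star x y : x \in V -> lack x = 1 -> x != Q ->
  y \in star x -> y != Q -> star x = star y.
Proof.
move=> xV dx xQ; rewrite in_setU1; have [->//|yx /=] := eqVneq y x.
move=> yfx yQ; have yV := far_V yfx.
have dy : lack y = 1.
  by have := far_lack_r pl xV yfx; rewrite concurrent_lack //; case: (_ \in _).
(* For e = 0 the degree n + 1 would exceed the bound k <= n of [transversal_uniq]. *)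
have e0 : 0 < e.
  case: (posnP e) => // e0; have := card_far pl QV; rewrite lackQ e0 mul0n.
  move/eqP; rewrite cards_eq0 => /eqP E.
  by move: dx; rewrite concurrent_lack // E in_set0.
have kn := net_deg_e.
apply: (@transversal_uniq _ V (star x) (star y) net_joined n net_deg x y) => //.
- exact: (plane_points pl).
- exact: star_V.
- exact: star_V.
- exact: card_star.
- exact: card_star.
- exact: ltnW.
- by move: kn e0; clear; lia.
- by have -> : n - net_deg = e.-1 by move: kn e0; clear; lia.
- by rewrite in_setU1 eqxx.
- by rewrite in_setU1 (far_sym xV yfx) orbT.
- by rewrite in_setU1 yfx orbT.
- by rewrite in_setU1 eqxx.
- exact: net_degree.
- exact: net_common.
- by move=> u v; apply: net_star_free.
- by move=> u v; apply: net_star_free.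
- move=> z zV zx; rewrite -(card_net_pencil zV).
  apply: (card_le_rel (r := fun (b : {set T}) u => u \in b)).
    move=> b; rewrite in_set => /andP [bn zb].
    have /eqP/cards1P [u E] := net_star bn xV dx xQ.
    have : u \in b :&: star x by rewrite E in_set1.
    rewrite in_setI => /andP [ub ux]; exists u => //; rewrite in_set ux.
    apply/net_joinedP; split; first by apply: contraNneq zx => ->.
    by exists b.
  move=> b c u; rewrite [b \in _]in_set [c \in _]in_set [u \in _]in_set.
  move=> /andP [/netB bB zb] /andP [/netB cB zc] /andP [_ /net_joinedP [zu _]] ub uc.
  exact: (line_uniq pl bB cB zu).
Qed.

Lemma concurrent_far x : x \in V -> x != Q -> 0 < lack x -> x \in far Q.
Proof. by move=> xV xQ; rewrite concurrent_lack //; case: (_ \in _). Qed.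

Lemma concurrent_clique_stars : clique_stars.
Proof.
move=> x y z xV dx yx zx yz.
have yV : y \in V by apply: subsetP yx; apply: star_V.
have zV : z \in V by apply: subsetP zx; apply: star_V.
have pos u : u \in star x -> 0 < lack u.
  rewrite in_setU1 => /orP [/eqP ->|ux]; first by rewrite dx.
  exact: far_lack_r ux.
have zy : z != y by rewrite eq_sym.
have [yQ|yQ] := eqVneq y Q.
  by rewrite yQ in zy *; apply: concurrent_far => //; apply: pos.
have [zQ|zQ] := eqVneq z Q.
  by apply: far_sym => //; rewrite zQ; apply: concurrent_far => //; apply: pos.
have dy : lack y = 1.
  by have := pos y yx; rewrite concurrent_lack //; case: (_ \in _).
suff E : star x = star y.
  by move: zx; rewrite E in_setU1 (negbTE zy).
have [xQ|xQ] := eqVneq x Q; last exact: concurrent_star.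
(* Here x = Q, so [star Q] is not treated as a transversal. Every deficient point other than Q is
   far from Q, which puts [star y] inside [star Q]. *)
apply/esym/eqP; rewrite eqEcard !(card_star pl) // leqnn andbT.
apply/subsetP => u; rewrite !in_setU1 xQ => /orP [/eqP ->|uy].
  by rewrite concurrent_far ?orbT // dy.
have [//|uQ /=] := eqVneq u Q; apply: concurrent_far => //; first exact: far_V uy.
exact: far_lack_r uy.
Qed.

Lemma concurrent_deep : #|deep| <= 1.
Proof.
rewrite -(cards1 Q); apply/subset_leq_card/subsetP => x; rewrite in_set in_set1.
case/andP => xV; have [//|xQ] := eqVneq x Q.
by rewrite concurrent_lack //; case: (_ \in _).
Qed.

Lemma concurrent_decomposes : exists M, decomposes n V B M.
Proof.
exact: (decomposes_clique_stars pl concurrent_clique_stars concurrent_deep).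
Qed.

End Concurrent.

(** * Two missing lines *)

Definition agree (c d : seq nat) := count (fun p => p.1 == p.2) (zip c d).

(** The parity of the number of inversions, that is, the sign of c as a permutation. *)
Definition odd_word (c : seq nat) : bool :=
  odd (count (fun p => nth 0 c p.2 < nth 0 c p.1)
    [:: (0, 1); (0, 2); (0, 3); (1, 2); (1, 3); (2, 3)]).

(** The 24 permutations as a concrete list, so that claims about all of them are decided by
    evaluation. *)
Definition words4 : seq (seq nat) :=
  [seq c <- [seq a ++ b | a <- [seq [:: i; j] | i <- iota 0 4, j <- iota 0 4],
                          b <- [seq [:: i; j] | i <- iota 0 4, j <- iota 0 4]]
  | uniq c].

Lemma words4P c : size c = 4 -> uniq c -> all (fun i => i < 4) c -> c \in words4.
Proof.
case: c => [|a [|b [|c [|d [|//]]]]] //= _ uc /and5P [a4 b4 c4 d4 _].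
rewrite mem_filter; apply/andP; split=> //; apply/allpairsP; exists ([:: a; b], [::
  c; d]).
by split=> //; apply/allpairsP; [exists (a, b)|exists (c, d)]; split=> //;
  rewrite mem_iota.
Qed.

(* Two permutations of four letters agreeing in exactly one place differ by a
   3-cycle, and the fixed point free even ones form, with the identity, the
   Klein four-group. *)
Lemma agree_parity c d : c \in words4 -> d \in words4 -> agree c d = 1 ->
  odd_word c = odd_word d.
Proof.
move=> cw dw; have /allP /(_ c cw) /allP /(_ d dw) /implyP H :
  all (fun c => all (fun d => (agree c d == 1) ==>
    (odd_word c == odd_word d)) words4) words4.
  by vm_compute.
by move/eqP/H/eqP.
Qed.

(** Relative to c, both d and f lie in the Klein four-group, so they agree everywhere or nowhere. *)
Lemma agree_klein c d f : c \in words4 -> d \in words4 -> f \in words4 ->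
  odd_word c = odd_word d -> odd_word c = odd_word f ->
  agree c d = 0 -> agree c f = 0 -> agree d f != 1.
Proof.
move=> cw dw fw; have /allP /(_ c cw) /allP /(_ d dw) /allP /(_ f fw) :
  all (fun c => all (fun d => all (fun f =>
    [&& odd_word c == odd_word d, odd_word c == odd_word f, agree c d == 0 & agree
      c f == 0]
    ==> (agree d f != 1)) words4) words4) words4.
  by vm_compute.
by move=> /implyP H *; apply: H; apply/and4P; split; apply/eqP.
Qed.

(** * Two missing lines without a common point: existence of a line of full points *)

Section LackTwo.
Variables (T : finType) (n : nat) (V : {set T}) (B : {set {set T}}).
Hypothesis pl : plane n V B.
Notation pencil := (pencil B).
Notation far := (far V B).
Notation star := (star V B).
Notation lack := (lack n B).
Notation misses := (misses B).
Notation pclass := (pclass B).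

Let n1 : 1 < n := plane_order pl.

Hypothesis n4 : 4 <= n.
Hypothesis card_2 : #|B| + 2 = n ^ 2 + n.
Hypothesis lack1 : forall x, x \in V -> lack x <= 1.

Definition short := [set x in V | lack x == 1].

Lemma short_V x : x \in short -> x \in V.
Proof. by rewrite inE => /andP []. Qed.

Lemma short_lack x : x \in V -> lack x = (x \in short).
Proof. by move=> xV; rewrite inE xV /=; have := lack1 xV; case: (lack x) => [|[|]]. Qed.

Lemma short_lack1 x : x \in short -> lack x = 1.
Proof. by rewrite inE => /andP [_ /eqP]. Qed.

Lemma far_short x y : x \in V -> y \in far x -> y \in short.
Proof.
move=> xV yx; have := far_lack_r pl xV yx; rewrite short_lack ?(far_V yx) //.
by case: (_ \in short).
Qed.

Lemma star_short x : x \in short -> star x \subset short.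
Proof.
move=> xW; apply/subsetP => y; rewrite in_setU1 => /orP [/eqP ->//|].
by apply: far_short; apply: short_V.
Qed.

Lemma card_short : #|short| = n * 2.
Proof.
rewrite -(sum_lack pl card_2) (eq_bigr _ short_lack) sum_mem_card.
by congr #|pred_of_set _|; apply/esym/setIidPr/subsetP => x /short_V.
Qed.

Lemma card_far_short x : x \in short -> #|far x| = n.-1.
Proof. by move=> xW; rewrite (card_far pl (short_V xW)) (short_lack1 xW) mul1n. Qed.

Definition nshort (L : {set T}) := #|L :&: short|.

Lemma sum_lack_line L : L \in B -> \sum_(x in L) lack x = nshort L.
Proof.
move=> LB; rewrite /nshort -sum_mem_card; apply: eq_bigr => x xL.
by rewrite short_lack // (line_V pl LB xL).
Qed.

Lemma card_pclass_nshort L : L \in B -> #|pclass L| + 2 = n + nshort L.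
Proof.
move=> LB; have := card_pclass pl LB; rewrite (sum_lack_line LB).
move: card_2; clear; lia.
Qed.

Lemma card_pencil_short x : x \in short -> #|pencil x| = n.
Proof.
by move=> xW; have := pencil_lack pl (short_V xW); rewrite (short_lack1 xW) addn1 =>
  -[].
Qed.

(** Of the 2n - 1 other deficient points n - 1 are far from x, so n are covered by the lines through
    x; x itself is counted once on each of its n lines. *)
Lemma sum_nshort_pencil x : x \in short -> \sum_(b in pencil x) nshort b = n * 2.
Proof.
move=> xW; have xV := short_V xW.
have sub : short :\ x \subset V.
  by apply/subsetP => y /setD1P [_ /short_V].
have xD : x \notin short :\ x by rewrite in_setD1 eqxx.
have := card_joined_pencil pl xD xV sub.
have -> : (short :\ x) :&: far x = far x.
  by apply/setIidPr/subsetP => y yx; rewrite in_setD1 (far_short xV yx) (far_neq yx).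
rewrite card_far_short //; have := cardsD1 x short; rewrite xW card_short => E1 E2.
have : \sum_(b in pencil x) nshort b = \sum_(b in pencil x) #|b :&:
  (short :\ x)| + #|pencil x|.
  rewrite -sum1_card -big_split; apply: eq_bigr => b; rewrite in_set => /andP [_ xb] /=.
  by rewrite /nshort (cardsD1 x) in_setI xb xW addnC setIDA.
rewrite card_pencil_short //; move: E1 E2 n1; clear; lia.
Qed.

Lemma sum_nshort : \sum_(L in B) nshort L = n * 2 * n.
Proof.
rewrite (double_count B short) (eq_bigr (fun=> n)) ?sum_nat_const ?card_short //.
by move=> x; apply: card_pencil_short.
Qed.

Lemma sum_nshort_sqr : \sum_(L in B) nshort L ^ 2 = n * 2 * (n * 2).
Proof.
transitivity (\sum_(x in short) \sum_(L in pencil x) nshort L); last first.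
  by rewrite (eq_bigr _ sum_nshort_pencil) sum_nat_const card_short.
transitivity (\sum_(L in B) \sum_(x in short) (x \in L) * nshort L).
  by apply: eq_bigr => L _; rewrite -big_distrl /= sum_mem_card setIC mulnn.
rewrite exchange_big; apply: eq_bigr => x _.
rewrite big_mkcond [RHS]big_mkcond; apply: eq_bigr => L _; rewrite in_set.
by case: (L \in B); case: (x \in L); rewrite /= ?mul1n ?mul0n.
Qed.

Lemma pclass_cover K y : K \in B -> y \in V -> y \notin short ->
  #|[set c in pclass K | y \in c]| = 1.
Proof.
move=> KB yV yW; have dy : lack y = 0 by rewrite short_lack // (negbTE yW).
have [yK|yK] := boolP (y \in K); first exact: pclass_at_in.
rewrite pclass_at //; have := misses_far pl KB yV yK; rewrite dy add0n => <-.
have -> : K :&: far y = set0; last by rewrite cards0.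
apply/setP => q; rewrite in_setI in_set0; apply/negP => /andP [_ qy].
by have := far_lack pl yV qy; rewrite dy.
Qed.

(** Far points are deficient, so x is the only point of K that can be far from y, and [misses_far]
    gives a parallel through y exactly in that case. *)
Lemma pclass_cover1 K x y : K \in B -> K :&: short = [set x] -> y \in short ->
  #|[set c in pclass K | y \in c]| = (y \in star x).
Proof.
move=> KB Kx yW; have yV := short_V yW.
have : x \in K :&: short by rewrite Kx in_set1.
rewrite in_setI => /andP [xK xW]; have xV := short_V xW.
have [yK|yK] := boolP (y \in K).
  rewrite pclass_at_in //; have : y \in K :&: short by rewrite in_setI yK.
  by rewrite Kx in_set1 => /eqP ->; rewrite in_setU1 eqxx.
rewrite pclass_at //; have := misses_far pl KB yV yK; rewrite (short_lack1 yW).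
have -> : K :&: far y = [set x] :&: far y.
  apply/setP => u; rewrite -Kx !in_setI -andbA; case uy: (u \in far y);
    rewrite ?andbF //.
  by rewrite (far_short yV uy) andbT.
have yx : y != x by apply: contraNneq yK => ->.
rewrite in_setU1 (negbTE yx) /= add1n => -[<-]; case yfx: (y \in far x).
  by rewrite (setIidPl _) ?cards1 // sub1set far_sym.
apply/eqP; rewrite cards_eq0; apply/eqP/setP => u; rewrite in_setI in_set1 in_set0.
by apply/negP => /andP [/eqP -> xy]; rewrite (far_sym yV xy) in yfx.
Qed.

Section NoFullLine.
Hypothesis nofull : forall L, L \in B -> 0 < nshort L.

(** If every line had one or two deficient points, w^2 + 2 = 3w summed over all lines would give |B|
    = n^2, but |B| = n^2 + n - 2. So some line has at least three; if the other n - 1 lines through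
    a deficient point of it had two or more, [sum_nshort_pencil] would be exceeded. *)
Lemma tangent_exists : exists K x, K \in B /\ K :&: short = [set x].
Proof.
have [/exists_inP [L LB wL]|] := boolP [exists L in B, 2 < nshort L]; last first.
  move=> /exists_inPn H.
  have : \sum_(L in B) (nshort L ^ 2 + 2) = \sum_(L in B) 3 * nshort L.
    apply: eq_bigr => L LB; have := nofull LB; have := H L LB.
    by case: (nshort L) => [|[|[|]]].
  rewrite big_split -big_distrr /= sum_nshort sum_nshort_sqr sum_nat_const.
  by move: card_2 n4; rewrite -!mulnn; move: (#|B|) => b; clear => *; exfalso; lia.
have : 0 < nshort L by apply: nofull.
rewrite card_gt0 => /set0Pn [x]; rewrite in_setI => /andP [xL xW].
have [/exists_inP [K]|] := boolP [exists K in pencil x, nshort K < 2].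
  rewrite in_set => /andP [KB xK] wK; exists K, x; split=> //.
  apply/eqP; rewrite eq_sym eqEcard sub1set in_setI xK xW cards1 /=.
  exact: wK.
move=> /exists_inPn H; exfalso.
have Lx : L \in pencil x by rewrite in_set LB.
have := sum_nshort_pencil xW; rewrite (big_setD1 L) //=.
have : \sum_(K in pencil x :\ L) 2 <= \sum_(K in pencil x :\ L) nshort K.
  by apply: leq_sum => K /setD1P [_ Kx]; rewrite leqNgt; apply: H.
have := cardsD1 L (pencil x); rewrite sum_nat_const Lx card_pencil_short //.
by move: (\sum_(K in _) _) (#|_ :\ _|) wL; clear; lia.
Qed.

(* The class of a line K with a single deficient point x has n - 1 members,
   pairwise disjoint; counting the deficient points they cover, all but one
   member K1 are again of this kind.  K1 has a further parallel, which contains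
   only deficient points, and too many of them are far from the two points of
   K1. *)
Lemma nofull_false : False.
Proof.
have [K [x [KB Kx]]] := tangent_exists.
have : x \in K :&: short by rewrite Kx in_set1.
rewrite in_setI => /andP [xK xW]; have xV := short_V xW.
pose S := star x; have cS : #|S| = n by rewrite (card_star pl) ?(short_lack1 xW).
have SW : S \subset short by apply: star_short.
pose Cl := pclass K.
have ClB c : c \in Cl -> c \in B by rewrite mem_pclass => /andP [].
have cCl : #|Cl| = n.-1.
  have := card_pclass_nshort KB; rewrite /nshort Kx cards1 -/Cl; move: n1; clear; lia.
have cov y : y \in V -> #|[set c in Cl | y \in c]| = (y \notin short) || (y \in S).
  move=> yV; have [yW|yW] := boolP (y \in short); last by rewrite pclass_cover.
  exact: pclass_cover1.
have covle y : y \in V -> #|[set c in Cl | y \in c]| <= 1.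
  by move=> yV; rewrite cov //; case: (_ || _).
have Cl_par c d : c \in Cl -> d \in Cl -> parallel c d.
  move=> cC dC; apply/negPn/negP => /not_parallel [cd [p pc pd]]; case/eqP: cd.
  have pV := line_V pl (ClB _ cC) pc.
  by apply: (card_le1_eqP (covle p pV)); rewrite in_set ?cC ?dC.
have Cl_sub c : c \in Cl -> Cl \subset pclass c.
  by move=> cC; apply/subsetP => d dC; rewrite mem_pclass ClB // Cl_par.
have Cl_in y : y \in S -> exists2 c, c \in Cl & y \in c.
  move=> yS; have yV := short_V (subsetP SW _ yS); have := cov y yV; rewrite yS orbT.
  move=> E; have : 0 < #|[set c in Cl | y \in c]| by rewrite E.
  by rewrite card_gt0 => /set0Pn [c]; rewrite in_set => /andP [cC yc]; exists c.
have S_in c y : c \in Cl -> y \in c -> y \in short -> y \in S.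
  move=> cC yc yW; have := cov y (short_V yW); rewrite yW /=; case: (y \in S) => //.
  move/eqP; rewrite cards_eq0 => /eqP E; have := in_set0 c; rewrite -E in_set.
  by rewrite cC yc.
have sumw : \sum_(c in Cl) nshort c = n.
  rewrite (double_count Cl short) (eq_bigr (fun y => (y \in S : nat))).
    by rewrite sum_mem_card (setIidPr SW).
  by move=> y yW; rewrite cov ?short_V // yW.
have [K1 K1C wK1] : exists2 K1, K1 \in Cl & 1 < nshort K1.
  have [/exists_inP [K1]|/exists_inPn H] := boolP [exists K1 in Cl, 1 < nshort K1].
    by exists K1.
  have : \sum_(c in Cl) nshort c <= \sum_(c in Cl) 1.
    by apply: leq_sum => c cC; rewrite leqNgt; apply: H.
  rewrite sumw sum1_card cCl; move: n1; clear; lia.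
have K1B := ClB _ K1C.
have cCl1 : #|Cl :\ K1| = n.-2 by have := cardsD1 K1 Cl; rewrite K1C cCl add1n => ->.
have bd c : c \in Cl :\ K1 -> nshort K1 + nshort c + n.-2.-1 <= n.
  move=> cC; have cC' : c \in Cl by move: cC => /setD1P [].
  rewrite -{2}sumw (big_setD1 K1) //= (big_setD1 c) //= -!addnA !leq_add2l.
  have <- : #|(Cl :\ K1) :\ c| = n.-2.-1.
    by have := cardsD1 c (Cl :\ K1); rewrite cC cCl1 add1n => ->.
  rewrite -sum1_card; apply: leq_sum => d /setD1P [_ /setD1P [_ dC]].
  exact: nofull (ClB _ dC).
have wK1' : nshort K1 = 2.
  have : 0 < #|Cl :\ K1| by rewrite cCl1; move: n4; clear; lia.
  rewrite card_gt0 => /set0Pn [c cC]; have := bd c cC.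
  have : 0 < nshort c by move: cC => /setD1P [_ /ClB]; apply: nofull.
  move: wK1 n4; clear; lia.
have w1 c : c \in Cl -> c != K1 -> nshort c = 1.
  move=> cC cK; have cC' : c \in Cl :\ K1 by rewrite in_setD1 cK.
  have := bd c cC'; have := nofull (ClB _ cC); move: wK1' n4; clear; lia.
(* The class of c also has n - 1 members, so it is [Cl], and [pclass_cover1] at c says that the
   deficient points covered by [Cl] form [star u]. *)
have tang c u v : c \in Cl -> c != K1 -> u \in c -> u \in S -> v \in S -> v \in star u.
  move=> cC cK uc uS vS; have cB := ClB _ cC; have uW := subsetP SW _ uS.
  have vW := subsetP SW _ vS.
  have cu : c :&: short = [set u].
    apply/esym/eqP; rewrite eqEcard sub1set in_setI uc uW cards1 /=.
    by have := w1 c cC cK; rewrite /nshort => ->.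
  have E : Cl = pclass c.
    apply/eqP; rewrite eqEcard Cl_sub // cCl.
    have := card_pclass_nshort cB; rewrite (w1 c cC cK); move: n1; clear; lia.
  have := pclass_cover1 cB cu vW; rewrite -E cov ?short_V // vS orbT.
  by case: (v \in star u).
have [y [y' [yK yK' yy]]] := card_gt1_ex wK1.
have yW : y \in short by move: yK; rewrite in_setI => /andP [].
have yW' : y' \in short by move: yK'; rewrite in_setI => /andP [].
have K1yy : K1 :&: short = [set y; y'].
  apply/esym/eqP; rewrite eqEcard cards2 yy -/(nshort K1) wK1' andbT.
  by apply/subsetP => u /set2P [->|->].
have inK1 u : u \in K1 -> u \in short -> u = y \/ u = y'.
  by move=> uK uW; apply/set2P; rewrite -K1yy in_setI uK.
have yS : y \in S by apply: (S_in K1) => //; move: yK; rewrite in_setI => /andP [].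
have yS' : y' \in S by apply: (S_in K1) => //; move: yK'; rewrite in_setI => /andP [].
(* With two deficient points on [K1] its class has n members, one more than [Cl]. *)
have [Ks KsP KsC] : exists2 Ks, Ks \in pclass K1 & Ks \notin Cl.
  apply/subsetPn; apply/negP => /subset_leq_card.
  have := card_pclass_nshort K1B; rewrite wK1' cCl; move: n1; clear; lia.
move: (KsP); rewrite mem_pclass => /andP [KsB K1Ks].
have KsK1 u : u \in Ks -> u \notin K1.
  move=> uK; apply/negP => uK1; case/negP: KsC.
  by rewrite -(parallel_eq K1Ks uK1 uK).
have KsW : Ks \subset short.
  apply/subsetP => u uK; apply/negPn/negP => uW; have uV := line_V pl KsB uK.
  have := cov u uV; rewrite uW /= => E.
  have : 0 < #|[set c in Cl | u \in c]| by rewrite E.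
  rewrite card_gt0 => /set0Pn [c]; rewrite in_set => /andP [cC uc]; case/negP: KsC.
  have le1 : #|[set c in pclass K1 | u \in c]| <= 1 by rewrite pclass_cover.
  have -> // : Ks = c.
  apply: (card_le1_eqP le1); rewrite in_set ?KsP ?uK // uc andbT.
  by apply: subsetP cC; apply: Cl_sub.
(* Of its n - 1 far points z already has the n - 2 points of S other than y and y'. *)
have farR z : z \in S -> z \in K1 -> #|far z :\: S| <= 1.
  move=> zS zK; have zW := subsetP SW _ zS.
  have : S :\: [set y; y'] \subset far z :&: S.
    apply/subsetP => u; rewrite in_setD => /andP [uyy uS]; rewrite in_setI uS andbT.
    have uW := subsetP SW _ uS; have [c cC uc] := Cl_in u uS.
    have cK : c != K1.
      apply: contraNneq uyy => cK; apply/set2P; apply: inK1 => //; by rewrite -cK.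
    have := tang c u z cC cK uc uS zS; rewrite in_setU1 => /orP [/eqP zu|zu].
      by case/negP: uyy; apply/set2P; rewrite -zu; apply: inK1.
    by apply: far_sym => //; apply: short_V.
  move/subset_leq_card; have := cardsID S (far z); rewrite card_far_short //.
  have := cardsID [set y; y'] S; rewrite cS.
  have : #|S :&: [set y; y']| <= 2.
    by rewrite -[X in _ <= X]/(true.+1) -yy -cards2 subset_leq_card // subsetIr.
  move: n4; clear; lia.
have KsS : #|Ks :&: S| <= 1.
  apply: card_le1_in => u v; rewrite !in_setI => /andP [uK uS] /andP [vK vS].
  apply/eqP/negPn/negP => uv; have [c cC uc] := Cl_in u uS.
  have cK : c != K1 by apply: contraNneq (KsK1 u uK) => <-.
  have := tang c u v cC cK uc uS vS; rewrite in_setU1 eq_sym (negbTE uv) /= => vu.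
  exact: (far_line vu KsB uK vK).
have KsR : Ks :\: S \subset (far y :\: S) :|: (far y' :\: S).
  apply/subsetP => r; rewrite in_setD => /andP [rS rK].
  have rW := subsetP KsW _ rK; have rV := short_V rW.
  have := misses_far pl K1B rV (KsK1 r rK); rewrite (short_lack1 rW) add1n => -[E].
  have : 0 < #|misses r K1|.
    rewrite card_gt0; apply/set0Pn; exists Ks; apply/missesP; split=> //.
    rewrite disjoint_sym; case/parallelP: K1Ks => // E1.
    by have := KsK1 r rK; rewrite E1 rK.
  rewrite -E card_gt0 => /set0Pn [u]; rewrite in_setI => /andP [uK ur].
  have fr := far_sym rV ur; rewrite in_setU !in_setD rS /=.
  by case: (inK1 u uK (far_short rV ur)) => <-; rewrite fr ?orbT.
(* [Ks] has at most one point in S and at most two outside, fewer than n >= 4. *)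
have := subset_leq_card KsR; have := leq_of_leqif (leq_card_setU (far y :\:
  S) (far y' :\: S)).
have yK1 : y \in K1 by move: yK; rewrite in_setI => /andP [].
have yK1' : y' \in K1 by move: yK'; rewrite in_setI => /andP [].
have := farR y yS yK1; have := farR y' yS' yK1'; have := cardsID S Ks.
rewrite (line_card pl KsB); move: KsS n4; clear; lia.
Qed.

End NoFullLine.

Lemma full_line_exists : exists2 L, L \in B & forall x, x \in L -> lack x = 0.
Proof.
have [/exists_inP [L LB /eqP wL]|/exists_inPn H] :=
  boolP [exists L in B, nshort L == 0].
  exists L => // x xL; rewrite short_lack ?(line_V pl LB xL) //; case xW:
    (x \in short) => //.
  by move/eqP: wL; rewrite cards_eq0 => /eqP/setP/(_ x); rewrite in_set0 in_setI xL xW.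
by case: nofull_false => L LB; rewrite lt0n; apply: H.
Qed.

End LackTwo.

(** * Two missing lines in order four: deficient points as permutations *)

Section OrderFour.
Variables (T : finType) (V : {set T}) (B : {set {set T}}).
Hypothesis pl : plane 4 V B.
Notation far := (far V B).
Notation star := (star V B).
Notation lack := (lack 4 B).
Notation pclass := (pclass B).
Notation joined := (joined B).
Notation clique_stars := (clique_stars 4 V B).
Notation short := (short 4 V B).

Hypothesis card_2 : #|B| + 2 = 4 ^ 2 + 4.
Hypothesis lack1 : forall x, x \in V -> lack x <= 1.
Variables L0 L1 : {set T}.
Hypothesis L0B : L0 \in B.
Hypothesis L1B : L1 \in B.
Hypothesis L01 : [disjoint L0 & L1].
Hypothesis L0full : forall x, x \in L0 -> lack x = 0.

Let P0 : pclass L0 = [set L0; L1].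
Proof.
apply/esym/eqP; rewrite eqEcard; apply/andP; split.
  by apply/subsetP => L /set2P [->|->];
    rewrite mem_pclass ?L0B ?L1B /parallel ?eqxx ?L01 ?orbT.
have -> : #|pclass L0| = 2.
  by have := dual_degree_e pl card_2 L0B L0full; rewrite /dual_degree; lia.
rewrite cards2; case: eqP => // E.
have /card_gt0P [x xL] : 0 < #|L0| by rewrite (line_card pl L0B).
by case: (disjointF L01 xL); rewrite -E.
Qed.

Let L0P : L0 \in pclass L0. Proof. by rewrite P0 set21. Qed.
Let L1P : L1 \in pclass L0. Proof. by rewrite P0 set22. Qed.

Lemma short_skew x b : x \in short -> b \in B -> x \in b -> b \in skew B L0.
Proof.
move=> xW bB xb; rewrite in_setD bB andbT; apply/negP => bP.
by have := P0_full pl L0B L0full bP xb; rewrite (short_lack1 xW).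
Qed.

Lemma short_join x p : x \in short -> p \in L0 ->
  exists b, [/\ b \in B, x \in b & p \in b].
Proof.
move=> xW pL; have pV := line_V pl L0B pL; apply/joinedP.
have [//|H] := boolP (joined x p).
have xp : x \in far p.
  rewrite in_set (short_V xW) joinedC H andbT /=; apply: contraTneq pL => <-.
  by apply/negP => /L0full; rewrite (short_lack1 xW).
by have := far_lack pl pV xp; rewrite (L0full pL).
Qed.

Lemma short_neq x p L : x \in short -> L \in pclass L0 -> p \in L -> x != p.
Proof.
move=> xW LP pL; apply: contraTneq pL => <-; apply/negP => xL.
by have := P0_full pl L0B L0full LP xL; rewrite (short_lack1 xW).
Qed.

Lemma skew_at b L p p' : b \in skew B L0 -> L \in pclass L0 -> p \in b -> p' \in b ->
  p \in L -> p' \in L -> p = p'.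
Proof.
move=> bs LP pb pb' pL pL'.
have le1 : #|L :&: b| <= 1 by rewrite (skew_meet pl L0B L0full bs LP).
by apply: (card_le1_eqP le1); rewrite in_setI ?pL ?pL'.
Qed.

(* A point x off [L0] and [L1] maps p on [L0] to the second point of the line
   xp on [L1]; with both lines enumerated this is a permutation of 0, ..., 3. *)
Definition image_index x p :=
  find (fun q => [exists b in B, [&& x \in b, p \in b & q \in b]]) (enum L1).

Definition word x := [seq image_index x p | p <- enum L0].

Lemma size_enum_line L : L \in B -> size (enum L) = 4.
Proof. by move=> LB; rewrite -cardE (line_card pl LB). Qed.

Lemma image_indexP x p : x \in short -> p \in L0 -> exists q b,
  [/\ q \in L1, image_index x p = index q (enum L1) &
      [/\ b \in B, x \in b, p \in b & q \in b]].
Proof.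
move=> xW pL; set a := (fun q => [exists b in B, [&& x \in b, p \in b & q \in b]]).
have ha : has a (enum L1).
  have [b [bB xb pb]] := short_join xW pL; have bs := short_skew xW bB xb.
  have /eqP/cards1P [q E] := skew_meet pl L0B L0full bs L1P.
  have : q \in L1 :&: b by rewrite E in_set1.
  rewrite in_setI => /andP [qL qb]; apply/hasP; exists q; first by rewrite mem_enum.
  by apply/exists_inP; exists b => //; rewrite xb pb qb.
pose q := nth x (enum L1) (find a (enum L1)).
have := nth_find x ha; rewrite -/q => /exists_inP [b bB /and3P [xb pb qb]].
exists q, b; split=> //; first by rewrite -mem_enum mem_nth // -has_find.
by rewrite index_uniq // -?has_find // enum_uniq.
Qed.

Lemma image_index_eq x p q b : x \in short -> p \in L0 -> q \in L1 -> b \in B ->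
  x \in b -> p \in b -> q \in b -> image_index x p = index q (enum L1).
Proof.
move=> xW pL qL bB xb pb qb; have [q' [b' [qL' -> [bB' xb' pb' qb']]]] :=
  image_indexP xW pL.
have E := line_uniq pl bB bB' (short_neq xW L0P pL) xb pb xb' pb'.
rewrite -E in qb'.
by rewrite (skew_at (short_skew xW bB xb) L1P qb qb' qL qL').
Qed.

Lemma index_enum_inj q q' :
  q \in L1 -> index q (enum L1) = index q' (enum L1) -> q = q'.
Proof.
move=> qL E; have qe : q \in enum L1 by rewrite mem_enum.
have qe' : q' \in enum L1 by rewrite -index_mem -E index_mem.
by rewrite -(nth_index q qe) E nth_index.
Qed.

Lemma word_in x : x \in short -> word x \in words4.
Proof.
move=> xW; apply: words4P; first by rewrite size_map size_enum_line.
  rewrite map_inj_in_uniq ?enum_uniq // => p p'; rewrite !mem_enum => pL pL' E.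
  have [q [b [qL Eq [bB xb pb qb]]]] := image_indexP xW pL.
  have [q' [b' [qL' Eq' [bB' xb' pb' qb']]]] := image_indexP xW pL'.
  have qq : q = q' by apply: index_enum_inj => //; rewrite -Eq -Eq'.
  rewrite -qq in qb'; have bb :=
    line_uniq pl bB bB' (short_neq xW L1P qL) xb qb xb' qb'.
  rewrite -bb in pb'.
  exact: (skew_at (short_skew xW bB xb) L0P pb pb').
apply/allP => i /mapP [p]; rewrite mem_enum => pL ->.
have [q [b [qL -> _]]] := image_indexP xW pL.
by rewrite -(size_enum_line L1B) index_mem mem_enum.
Qed.

(** If the words agree at p, with image q, the line pq contains both x and y. Conversely a line
    through x and y meets [L0] in exactly one point, and the words agree there. *)
Lemma agree_word x y : x \in short -> y \in short -> x != y ->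
  agree (word x) (word y) = joined x y.
Proof.
move=> xW yW xy.
have -> : agree (word x) (word y) = #|[set p in L0 | image_index x p == image_index
  y p]|.
  have -> : agree (word x) (word y) = count (fun p =>
    image_index x p == image_index y p) (enum L0).
    by rewrite /agree /word; elim: (enum L0) => //= p s ->.
  rewrite cardE -size_filter; apply/perm_size/uniq_perm.
  - by rewrite filter_uniq ?enum_uniq.
  - exact: enum_uniq.
  by move=> p; rewrite mem_filter !mem_enum in_set andbC.
have meet p : p \in L0 -> image_index x p = image_index y p ->
    exists b, [/\ b \in B, x \in b, y \in b & p \in b].
  move=> pL; have [q [b [qL -> [bB xb pb qb]]]] := image_indexP xW pL.
  have [q' [b' [_ -> [bB' yb' pb' qb']]]] := image_indexP yW pL.
  move/(index_enum_inj qL) => E; rewrite -E in qb'; exists b; split=> //.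
  have pq : p != q by apply/eqP => pq; apply: (disjointF L01 pL); rewrite pq.
  by rewrite (line_uniq pl bB bB' pq pb qb pb' qb').
case: joinedP => [[b [bB xb yb]]|H].
  transitivity #|L0 :&: b|; last exact:
    (skew_meet pl L0B L0full (short_skew xW bB xb) L0P).
  apply: eq_card => p; rewrite in_set in_setI; case pL: (p \in L0) => //=;
    apply/eqP/idP => [E|pb].
    have [c [cB xc yc pc]] := meet p pL E.
    by rewrite (line_uniq pl bB cB xy xb yb xc yc).
  have /eqP/cards1P [q E] := skew_meet pl L0B L0full (short_skew xW bB xb) L1P.
  have : q \in L1 :&: b by rewrite E in_set1.
  rewrite in_setI => /andP [qL qb].
  by rewrite (image_index_eq xW pL qL bB xb pb qb) (image_index_eq yW pL qL bB yb
    pb qb).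
apply/eqP; rewrite cards_eq0; apply/eqP/setP => p; rewrite in_set0 in_set.
by apply/negP => /andP [pL /eqP E]; have [b [? ? ? ?]] := meet p pL E; apply: H;
  exists b.
Qed.

(** By [agree_parity] z has the parity of every point joined to it, which with z itself makes at
    least 1 + (8 - 4) = 5 of the 8 deficient points. Two parity classes of that size do not fit. *)
Lemma word_parity x y : x \in short -> y \in short -> odd_word (word x) = odd_word
  (word y).
Proof.
move=> xW yW; apply/eqP/negPn/negP => ne.
pose C z := [set u in short | odd_word (word u) == odd_word (word z)].
have big z : z \in short -> 5 <= #|C z|.
  move=> zW; have zV := short_V zW.
  have sub : z |: (short :\: star z) \subset C z.
    apply/subsetP => u; rewrite in_setU1 => /orP [/eqP ->|];
      first by rewrite in_set zW eqxx.
    rewrite in_setD in_setU1 negb_or => /andP [/andP [uz uf] uW].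
    rewrite in_set uW; apply/eqP/agree_parity; rewrite ?word_in // agree_word //.
    by move: uf; rewrite in_set (short_V uW) uz /= negbK joinedC => ->.
  have := subset_leq_card sub; rewrite cardsU1 in_setD in_setU1 eqxx /= cardsD.
  rewrite (setIidPr (star_short pl lack1 zW)) (card_short pl card_2 lack1).
  by rewrite (card_star pl zV) ?(short_lack1 zW).
have : [disjoint C x & C y].
  rewrite -setI_eq0; apply/eqP/setP => u; rewrite in_setI !in_set.
  by apply/negP => /andP [/andP [_ /eqP E] /andP [_ /eqP E']]; rewrite -E E' eqxx in ne.
move/disjoint_setI0 => E; have := cardsUI (C x) (C y); rewrite E cards0 addn0.
have : #|C x :|: C y| <= #|short|.
  by apply/subset_leq_card; rewrite subUset; apply/andP; split; apply/subsetP => u;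
    rewrite in_set => /andP [].
have := big x xW; have := big y yW; rewrite (card_short pl card_2 lack1); clear; lia.
Qed.

Lemma order_four_clique_stars : clique_stars.
Proof.
move=> x y z xV dx yx zx yz.
have xW : x \in short by rewrite in_set xV dx.
have yW : y \in short := subsetP (star_short pl lack1 xW) _ yx.
have zW : z \in short := subsetP (star_short pl lack1 xW) _ zx.
move: yx zx; rewrite !in_setU1; have [yx _|yx /= yf] := eqVneq y x.
  by rewrite -yx eq_sym (negbTE yz).
have [-> _|zx /= zf] := eqVneq z x; first exact: far_sym.
have far0 u : u \in far x -> agree (word x) (word u) = 0.
  move=> uf; rewrite agree_word ?(far_short pl lack1 xV uf) //; last first.
    by rewrite eq_sym (far_neq uf).
  by move: uf; rewrite in_set => /and3P [_ _ /negbTE ->].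
have := agree_klein (word_in xW) (word_in yW) (word_in zW) (word_parity xW yW)
  (word_parity xW zW) (far0 y yf) (far0 z zf).
rewrite agree_word // in_set (short_V zW) (eq_sym z y) yz /=.
by case: (joined y z).
Qed.

End OrderFour.

Section LackTwoDecomposes.
Variables (T : finType) (n : nat) (V : {set T}) (B : {set {set T}}).
Hypothesis pl : plane n V B.
Notation lack := (lack n B).
Notation deep := (deep n V B).

Lemma lack_two_decomposes : 4 <= n -> #|B| + 2 = n ^ 2 + n ->
  #|deep| <= 1 /\ exists M, decomposes n V B M.
Proof.
move=> n4 card_2.
have [/exists_inP [Q QV /eqP dQ]|/exists_inPn H] := boolP [exists x in V, lack x == 2].
  split; first exact: (concurrent_deep pl card_2 QV dQ).
  by apply: (concurrent_decomposes pl card_2 QV dQ); apply: leq_trans n4.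
have lack1 x : x \in V -> lack x <= 1.
  move=> xV; have := lack_le pl card_2 xV; rewrite leq_eqVlt => /orP [/eqP dx|//].
  by have := H x xV; rewrite dx.
have deep0 : #|deep| <= 1.
  suff -> : deep = set0 by rewrite cards0.
  apply/setP => x; rewrite in_set in_set0; apply/negP => /andP [xV].
  by rewrite ltnNge lack1.
split=> //; have [L0 L0B L0full] := full_line_exists pl n4 card_2 lack1.
(* The dual net needs e^2 = 4 < n, which leaves n = 4. *)
have [n5|] := ltnP 4 n; first exact: (full_line_decomposes pl card_2 L0B L0full).
move=> n4'; have E : n = 4 by apply/eqP; rewrite eqn_leq n4 n4'.
subst n; apply: (decomposes_clique_stars pl _ deep0).
have : 1 < #|pclass B L0|.
  by have := dual_degree_e pl card_2 L0B L0full; rewrite /dual_degree; clear; lia.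
move/card_gt1_ex => [L [L' [LP LP' LL]]].
have [L1 [L1B L01 d01]] : exists L1, [/\ L1 \in B, L0 != L1 & parallel L0 L1].
  move: LP LP'; rewrite !mem_pclass => /andP [LB L0L] /andP [LB' L0L'].
  have [E|NE] := eqVneq L0 L; last by exists L.
  by exists L'; split=> //; rewrite E.
apply: (@order_four_clique_stars _ _ _ pl card_2 lack1 L0 L1) => //.
by case/parallelP: d01 => // E; rewrite E eqxx in L01.
Qed.

End LackTwoDecomposes.

(** * Derived structures *)

Section Derived.
Variables (T : finType) (n : nat) (I : incidence T).
Hypothesis hn : 2 <= n.
Hypothesis hI : is_partial_design 3 (n ^ 2 + 1) (n + 1) 1 I.

Notation points P := (points (derived I P)).
Notation lines P := (blocks (derived I P)).

Lemma linesP P b : reflect (exists C, [/\ C \in blocks I, P \in C & b = C :\ P])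
  (b \in lines P).
Proof.
apply: (iffP imsetP) => [[C]|[C [CI PC ->]]]; last by exists C; rewrite ?inE ?CI.
by rewrite inE => /andP [CI PC] ->; exists C.
Qed.

Lemma block_uniq C D x y z : C \in blocks I -> D \in blocks I ->
  x != y -> x != z -> y != z -> [set x; y; z] \subset C -> [set x; y; z] \subset D ->
  C = D.
Proof.
case: hI => _ bs H CI DI xy xz yz sC sD.
have sI := subset_trans sC (bs C CI).1.
have c3 : #|[set x; y; z]| = 3.
  by rewrite setUC cardsU1 cards2 xy !inE !(eq_sym z) (negbTE xz) (negbTE yz).
by apply: (card_le1_eqP (H _ sI c3)); rewrite inE ?CI ?DI.
Qed.

Lemma sub3 (x y z : T) (C : {set T}) :
  ([set x; y; z] \subset C) = [&& x \in C, y \in C & z \in C].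
Proof. by rewrite !subUset !sub1set andbA. Qed.

Lemma derived_plane P : P \in Defs.points I -> plane n (points P) (lines P).
Proof.
case: hI => cI bs H PI; split=> //.
- by have := cardsD1 P (Defs.points I); rewrite PI cI addn1 add1n => -[].
- by move=> b /linesP [C [CI _ ->]]; apply: setSD; have [] := bs C CI.
- move=> b /linesP [C [CI PC ->]]; have [_ cC] := bs C CI.
  by have := cardsD1 P C; rewrite PC cC addn1 add1n => -[].
move=> b c x y /linesP [C [CI PC ->]] /linesP [D [DI PD ->]] xy.
move=> /setD1P [xP xC] /setD1P [yP yC] /setD1P [_ xD] /setD1P [_ yD].
congr (_ :\ _); apply: (@block_uniq C D P x y) => //; rewrite ?sub3 ?PC ?PD ?xC ?xD //.
- by rewrite eq_sym.
- by rewrite eq_sym.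
Qed.

Lemma card_lines_through P : #|lines P| = #|[set C in blocks I | P \in C]|.
Proof.
rewrite card_in_imset; first by apply: eq_card => C; rewrite !inE.
move=> C D; rewrite !inE => /andP [_ PC] /andP [_ PD] E.
by rewrite -(setD1K PC) E setD1K.
Qed.

Lemma parallelism_trans (J : incidence T) : parallelism_equiv J ->
  forall b c d, b \in blocks J -> c \in blocks J -> d \in blocks J ->
  parallel b c -> parallel c d -> parallel b d.
Proof.
move=> H b c d bB cB dB bc cd; have [_ H2] := H b c d bB cB dB.
by rewrite (H2 bc).
Qed.

Local Open Scope ring_scope.

Lemma natr_le_sqrt (R : rcfType) (m : nat) :
  (m%:R <= Num.sqrt (n%:R : R)) = (m ^ 2 <= n)%N.
Proof.
by rewrite -[LHS]ler_sqr ?nnegrE ?ler0n ?sqrtr_ge0 // sqr_sqrtr ?ler0n // -natrX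
  ler_nat.
Qed.

Lemma natr_lt_sqrt (R : rcfType) (m : nat) :
  (m%:R < Num.sqrt (n%:R : R)) = (m ^ 2 < n)%N.
Proof.
by rewrite -[LHS]ltr_sqr ?nnegrE ?ler0n ?sqrtr_ge0 // sqr_sqrtr ?ler0n // -natrX
  ltr_nat.
Qed.

(** The last clause is kept for the gluing, where it bounds the number of deep points on a missing
    line. *)
Lemma cond_decomposes (R : rcfType) P : P \in Defs.points I ->
  [\/ cond_i R n I P, cond_ii n I P | cond_iii R n I P] ->
  exists e M, [/\ (#|lines P| + e = n ^ 2 + n)%N,
    decomposes n (points P) (lines P) M &
    (#|deep n (points P) (lines P)| <= 1)%N \/ (e ^ 2 <= n)%N].
Proof.
move=> PI; have pl := derived_plane PI; pose e := (n ^ 2 + n - #|lines P|)%N.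
have He : (#|lines P| + e = n ^ 2 + n)%N by rewrite subnKC // (card_lines pl).
case.
- case=> H /parallelism_trans tr.
  have se : (e ^ 2 <= n)%N.
    rewrite -(natr_le_sqrt R); move: H.
    by rewrite -card_lines_through -He natrD lerBlDr lerD2l.
  by have [M dM] := trans_decomposes pl tr He se; exists e, M; split=> //; right.
- case=> H /parallelism_trans tr.
  have d1 : (#|deep n (points P) (lines P)| <= 1)%N.
    apply: leq_trans H; apply/subset_leq_card/subsetP => Q.
    rewrite !inE => /andP [-> ]; rewrite /lack /pencil /valency; lia.
  have [M dM] := decomposes_clique_stars pl (trans_clique_stars pl tr) d1.
  by exists e, M; split=> //; left.
case=> f Ef; have {Ef} -> : f = e%:Z by lia.
have sml : e%:~R < Num.sqrt (n%:R : R) + 1 -> (e.-1 ^ 2 < n)%N.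
  case: (e) => [|m] /=; first by move=> _; lia.
  by rewrite -pmulrn -natr1 ltrD2r natr_lt_sqrt.
have conc Q : Q \in points P -> lack n (lines P) Q = e -> (e.-1 ^ 2 < n)%N ->
    exists e M, [/\ (#|lines P| + e = n ^ 2 + n)%N,
    decomposes n (points P) (lines P) M &
    (#|deep n (points P) (lines P)| <= 1)%N \/ (e ^ 2 <= n)%N].
  move=> QV dQ se; have [M dM] := concurrent_decomposes pl He QV dQ se.
  by exists e, M; split=> //; left; apply: concurrent_deep dQ.
case.
- case=> se [Q QV vQ]; apply: (conc Q) => //; last exact: sml.
  by have := pencil_lack pl QV; move: vQ; rewrite /valency /pencil; lia.
- case; rewrite -pmulrn natr_lt_sqrt => se [L LB LQ].
  have full x : x \in L -> lack n (lines P) x = 0%N.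
    move=> xL; have := LQ x xL; have := pencil_lack pl (line_V pl LB xL).
    rewrite /valency /pencil; lia.
  have [M dM] := full_line_decomposes pl He LB full se.
  by exists e, M; split=> //; right; apply: ltnW.
(* The lacks add up to n > 0, so some point has lack 1 = e, and the single missing line is trivially
   concurrent. *)
- case=> _ e1; have {}e1 : e = 1%N by lia.
  have [/exists_inP [Q QV /eqP dQ]|/exists_inPn H] :=
    boolP [exists x in points P, lack n (lines P) x == 1%N].
    by apply: (conc Q) => //; rewrite ?e1 //; lia.
  have := sum_lack pl He; rewrite e1 big1; first by lia.
  move=> x xV; have := lack_le pl He xV; have := H x xV; rewrite e1.
  by case: (lack _ _ x) => [|[|]].
case=> n4 e2; have {}e2 : e = 2 by lia.
rewrite e2 in He; have [d1 [M dM]] := lack_two_decomposes pl n4 He.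
by exists 2, M; split=> //; left.
Qed.

End Derived.

(** * Gluing the missing lines *)

Lemma decomposes_star (T : finType) (n : nat) (V : {set T}) (B : {set {set T}})
    (pl : plane n V B) M m x : decomposes n V B M -> x \in V ->
  lack n B x = 1 -> m \in M -> x \in m -> m = star V B x.
Proof.
case=> Mn Mfar _ _ xV dx mM xm; apply/eqP; rewrite eqEcard (card_star pl xV dx).
rewrite (Mn _ mM).2 leqnn andbT; apply/subsetP => y ym; rewrite in_setU1.
by have [//|yx /=] := eqVneq y x; apply: (Mfar m); rewrite // eq_sym.
Qed.

(** In [simple_point], f is the lack shared by P and Q, while a and b count the missing lines at P
    not through Q and at Q not through P; they are replaced by 0 if there is at most one deep point.
    At most a + f * b of the n - 1 points of L other than Q are then deep for P or Q. *)
Lemma few_deep n f a b : 1 < n -> 1 < f ->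
  a = 0 \/ (f + a) ^ 2 <= n -> b = 0 \/ (f + b) ^ 2 <= n -> a + f * b < n.-1.
Proof.
move=> n1 f1; have key c : (f + c) ^ 2 <= n -> c + f * c < n.-1.
  by rewrite -mulnn mulnDl !mulnDr => H; nia.
case=> [->|Ha]; case=> [->|Hb]; rewrite ?muln0 ?addn0 ?add0n; first lia.
- by apply: leq_ltn_trans (key b Hb); rewrite leq_addl.
- by apply: leq_ltn_trans (key a Ha); rewrite leq_addr.
have [ab|/ltnW ba] := leqP a b.
  by apply: leq_ltn_trans (key b Hb); rewrite leq_add2r.
by apply: leq_ltn_trans (key a Ha); rewrite leq_add2l leq_mul2l ba orbT.
Qed.

Section Completion.
Variables (T : finType) (n : nat) (I : incidence T).
Hypothesis hn : 2 <= n.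
Hypothesis hI : is_partial_design 3 (n ^ 2 + 1) (n + 1) 1 I.

Notation pts := (points I).
Notation V P := (points (derived I P)).
Notation lines P := (blocks (derived I P)).

Variables (e : T -> nat) (M : T -> {set {set T}}).
Hypothesis card_e : forall P, P \in pts -> #|lines P| + e P = n ^ 2 + n.
Hypothesis decM : forall P, P \in pts -> decomposes n (V P) (lines P) (M P).
Hypothesis smallM : forall P, P \in pts ->
  #|deep n (V P) (lines P)| <= 1 \/ e P ^ 2 <= n.

Notation far P := (far (V P) (lines P)).
Notation lack P := (lack n (lines P)).

Let pl P : P \in pts -> plane n (V P) (lines P) := @derived_plane T n I hn hI P.

(** [far P Q] in a form symmetric in the three points; this symmetry is the only link between
    different derived structures. *)
Definition uncovered P Q R := [&& P \in pts, Q \in pts, R \in pts, P != Q, P != R,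
  Q != R & ~~ [exists C in blocks I, [&& P \in C, Q \in C & R \in C]]].

Lemma uncovered_swap P Q R : uncovered P Q R = uncovered Q P R.
Proof.
rewrite /uncovered (eq_sym Q P); have -> :
  [exists C in blocks I, [&& P \in C, Q \in C & R \in C]] =
  [exists C in blocks I, [&& Q \in C, P \in C & R \in C]].
  by apply: eq_existsb => C; case: (P \in C); case: (Q \in C).
by case: (P \in pts); case: (Q \in pts); case: (P == Q); case: (P == R); case: (Q == R);
  rewrite /= ?andbF.
Qed.

Lemma in_V P Q : (Q \in V P) = (Q != P) && (Q \in pts).
Proof. by rewrite in_setD1. Qed.

Lemma far_uncovered P Q R : P \in pts -> Q \in V P -> (R \in far P Q) = uncovered P Q R.
Proof.
move=> PI; rewrite in_V => /andP [QP QI]; rewrite in_set in_V /uncovered PI QI.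
rewrite (eq_sym P Q) QP (eq_sym P R) (eq_sym Q R) /=.
have -> : joined (lines P) Q R = (R != P) &&
    [exists C in blocks I, [&& P \in C, Q \in C & R \in C]].
  apply/joinedP/andP => [[b [/linesP [C [CI PC ->]]]]|[RP /exists_inP [C CI]]].
    move=> /setD1P [_ QC] /setD1P [RP RC]; split=> //.
    by apply/exists_inP; exists C => //; rewrite PC QC RC.
  move=> /and3P [PC QC RC]; exists (C :\ P); rewrite !in_setD1 QP QC RP RC.
  by split=> //; apply/linesP; exists C.
by case: (R == P); case: (R \in pts); case: (R == Q); rewrite /= ?andbF.
Qed.

Lemma far_swap P Q : P \in pts -> Q \in V P -> far P Q = far Q P.
Proof.
move=> PI QV; have := QV; rewrite in_V => /andP [QP QI].
apply/setP => R; rewrite far_uncovered // uncovered_swap far_uncovered //.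
by rewrite in_V eq_sym QP.
Qed.

Lemma in_V_swap P Q : P \in pts -> Q \in V P -> Q \in pts /\ P \in V Q.
Proof. by move=> PI; rewrite !in_V => /andP [QP QI]; rewrite eq_sym QP. Qed.

Lemma lack_swap P Q : P \in pts -> Q \in V P -> lack P Q = lack Q P.
Proof.
move=> PI QV; have [QI PV] := in_V_swap PI QV.
have := card_far (pl PI) QV; rewrite far_swap // (card_far (pl QI) PV).
by move=> /eqP; rewrite eqn_pmul2r; [move/eqP|move: hn; clear; lia].
Qed.

Lemma M_V P L Q : P \in pts -> L \in M P -> Q \in L -> Q \in V P.
Proof. by move=> PI LM; have [/(_ L LM) [/subsetP s _] _ _ _] := decM PI; apply: s. Qed.

(** Both missing lines are forced to be stars, Q |: [far P Q] and P |: [far Q P], and the two far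
    sets coincide. *)
Lemma M_swap1 P Q L : P \in pts -> L \in M P -> Q \in L -> lack P Q = 1 ->
  (P |: L) :\ Q \in M Q.
Proof.
move=> PI LM QL d1; have QV := M_V PI LM QL; have [QI PV] := in_V_swap PI QV.
have d1' : lack Q P = 1 by rewrite -lack_swap.
have LE : L = Q |: far P Q := decomposes_star (pl PI) (decM PI) QV d1 LM QL.
have : 0 < #|[set m in M Q | P \in m]|.
  by rewrite (decomposes_lack (pl QI) (decM QI) PV) d1'.
rewrite card_gt0 => /set0Pn [m]; rewrite in_set => /andP [mM Pm].
have mE : m = P |: far Q P := decomposes_star (pl QI) (decM QI) PV d1' mM Pm.
suff -> : (P |: L) :\ Q = m by [].
rewrite LE mE (far_swap PI QV); apply/setP => R.
rewrite !in_setU1 in_setD1 !in_setU1.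
have [->|RQ /=] := eqVneq R Q; last by case: (R == P).
move: (QV); rewrite in_V => /andP [/negbTE -> _] /=.
by apply/esym/negP; rewrite -far_swap // => /far_neq; rewrite eqxx.
Qed.

(** * Pairs of points with several missing lines *)

Section DeepPair.
Variables (P Q : T) (L : {set T}).
Hypothesis PI : P \in pts.
Hypothesis LM : L \in M P.
Hypothesis QL : Q \in L.
Hypothesis deepPQ : 1 < lack P Q.

Let QV : Q \in V P := M_V PI LM QL.
Let QI : Q \in pts := (in_V_swap PI QV).1.
Let PV : P \in V Q := (in_V_swap PI QV).2.
Notation f := (lack P Q).

Let two_lines X R m : X \in pts -> R \in V X -> 1 < lack X R -> m \in M X ->
  exists2 m', m' \in M X & R \in m' /\ m' != m.
Proof.
move=> XI RV; rewrite -(decomposes_lack (pl XI) (decM XI) RV) => c2 mM.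
have [/exists_inP [m' m'R mm]|/exists_inPn H] :=
  boolP [exists m' in [set m in M X | R \in m], m' != m].
  by exists m'; move: m'R; rewrite in_set => /andP [].
case/card_gt1_ex: c2 => u [v [/H + /H + /eqP uv]].
by rewrite !negbK => /eqP E /eqP E'; case: uv; rewrite E E'.
Qed.

(** A deep point R of L is on a second missing line, which avoids Q because it meets L only in R.
    There are e P - f missing lines avoiding Q, and different R use different ones. *)
Lemma deep_on_line : exists2 a, a = 0 \/ (f + a) ^ 2 <= n &
  #|[set R in L :\ Q | 1 < lack P R]| <= a.
Proof.
have [d1|se] := smallM PI.
  exists 0; first by left.
  rewrite leqn0 cards_eq0; apply/eqP/setP => R; rewrite in_set0 in_set in_setD1.
  apply/negP => /andP [/andP [/eqP RQ RL] dR]; apply: RQ.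
  by apply: (card_le1_eqP d1); rewrite in_set ?(M_V PI LM RL) ?QV.
have [Mn Mfar Mcov Muniq] := decM PI.
have eE : #|[set m in M P | Q \notin m]| + f = e P.
  rewrite -(decomposes_card (pl PI) (decM PI) (card_e PI)).
  rewrite -(decomposes_lack (pl PI) (decM PI) QV) -(cardsID [set m :
    {set T} | Q \in m] (M P)) addnC.
  by congr (_ + _); apply: eq_card => m; rewrite !in_set // andbC.
exists #|[set m in M P | Q \notin m]|; first by right; rewrite addnC eE.
apply: (card_le_rel (r := fun R (m : {set T}) => R \in m)).
  move=> R; rewrite in_set in_setD1 => /andP [/andP [RQ RL] dR].
  have [m mM [Rm mL]] := two_lines PI (M_V PI LM RL) dR LM; exists m => //.
  rewrite in_set mM; apply/negP => Qm; case/eqP: mL.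
  exact: (Muniq m L R Q).
move=> R R' m; rewrite [R \in _]in_set [R' \in _]in_set [m \in _]in_set !in_setD1 =>
  /andP [/andP [_ RL] _] /andP [/andP [_ RL'] _].
move=> /andP [mM Qm] Rm Rm'; apply/eqP/negPn/negP => RR; case/negP: Qm.
by rewrite (Muniq m L R R').
Qed.

(** It is not yet known that the points of L :\ Q lie on one missing line at Q, only that they are
    far from P there. So a deep R is recorded by two missing lines through it, one of the f through
    P and one of the e Q - f avoiding P; hence the factor f. *)
Lemma deep_on_far : exists2 b, b = 0 \/ (f + b) ^ 2 <= n &
  #|[set R in L :\ Q | 1 < lack Q R]| <= f * b.
Proof.
have fE : f = lack Q P by apply: lack_swap.
have farR R : R \in L :\ Q -> R \in far Q P.
  rewrite in_setD1 => /andP [RQ RL]; rewrite -far_swap //.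
  by have [_ Mfar _ _] := decM PI; apply: (Mfar L) => //; rewrite eq_sym.
have [d1|se] := smallM QI.
  exists 0; first by left.
  rewrite muln0 leqn0 cards_eq0; apply/eqP/setP => R; rewrite in_set0 in_set.
  apply/negP => /andP [/farR RL dR]; case/eqP: (far_neq RL).
  by apply: (card_le1_eqP d1); rewrite in_set ?PV -?fE // dR (far_V RL).
have [Mn Mfar Mcov Muniq] := decM QI.
have eE : #|[set m in M Q | P \notin m]| + f = e Q.
  rewrite fE -(decomposes_card (pl QI) (decM QI) (card_e QI)).
  rewrite -(decomposes_lack (pl QI) (decM QI) PV) -(cardsID [set m :
    {set T} | P \in m] (M Q)) addnC.
  by congr (_ + _); apply: eq_card => m; rewrite !in_set // andbC.
exists #|[set m in M Q | P \notin m]|; first by right; rewrite addnC eE.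
rewrite {1}fE -(decomposes_lack (pl QI) (decM QI) PV) -cardsX.
apply: (card_le_rel (r := fun R (m : {set T} * {set T}) => (R \in m.1) && (R \in m.2))).
  move=> R; rewrite in_set => /andP [/farR RL dR].
  have [m1 [m1M Pm1 Rm1]] := Mcov P R PV RL.
  have [m2 m2M [Rm2 m21]] := two_lines QI (far_V RL) dR m1M.
  exists (m1, m2); last by rewrite /= Rm1.
  rewrite in_setX !in_set m1M Pm1 m2M /=; apply/negP => Pm2; case/eqP: m21.
  apply: (Muniq m2 m1 R P) => //; exact: far_neq RL.
move=> R R' [m1 m2] _ _; rewrite in_setX !in_set /=.
move=> /andP [/andP [m1M Pm1] /andP [m2M Pm2]] /andP [R1 R2] /andP [R1' R2'].
apply/eqP/negPn/negP => RR; case/negP: Pm2.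
by rewrite -(Muniq m1 m2 R R').
Qed.

Lemma simple_point : exists R, [/\ R \in L, R != Q, lack P R = 1 & lack Q R = 1].
Proof.
have [a Ha ca] := deep_on_line; have [b Hb cb] := deep_on_far.
have lt := few_deep hn deepPQ Ha Hb.
have cL : #|L :\ Q| = n.-1.
  have [Mn _ _ _] := decM PI; have := cardsD1 Q L; rewrite QL (Mn L LM).2 add1n.
  by move=> ->.
pose D := [set R in L :\ Q | 1 < lack P R] :|: [set R in L :\ Q | 1 < lack Q R].
have : #|D| < #|L :\ Q|.
  rewrite cL; apply: leq_ltn_trans lt; apply: leq_trans (leq_add ca cb).
  exact: leq_of_leqif (leq_card_setU _ _).
move=> cD; have [R RL RD] : exists2 R, R \in L :\ Q & R \notin D.
  by apply/subsetPn; apply/negP => /subset_leq_card; rewrite leqNgt cD.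
move: RD; rewrite in_setU ![R \in [set _ in _ | _]]in_set RL /= negb_or -!leqNgt =>
  /andP [d1 d2].
move: RL; rewrite in_setD1 => /andP [RQ RL].
have Rf : R \in far P Q.
  by have [_ Mfar _ _] := decM PI; apply: (Mfar L) => //; rewrite eq_sym.
exists R; split=> //; apply/eqP; rewrite eqn_leq ?d1 ?d2 /=.
  exact: (far_lack_r (pl PI) QV Rf).
by rewrite far_swap // in Rf; exact: (far_lack_r (pl QI) PV Rf).
Qed.

End DeepPair.

(* If P and Q are deep for each other, go through a point R of L that is
   simple for both. *)
Lemma M_swap P Q L : P \in pts -> L \in M P -> Q \in L -> (P |: L) :\ Q \in M Q.
Proof.
move=> PI LM QL; have QV := M_V PI LM QL; have [QI PV] := in_V_swap PI QV.
have d0 : 0 < lack P Q.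
  rewrite -(decomposes_lack (pl PI) (decM PI) QV) card_gt0; apply/set0Pn.
  by exists L; rewrite in_set LM.
have [d1|d1] := leqP (lack P Q) 1.
  by apply: M_swap1 => //; apply/eqP; rewrite eqn_leq d1.
have [R [RL RQ dPR dQR]] := simple_point PI LM QL d1.
have RV := M_V PI LM RL; have [RI PR] := in_V_swap PI RV.
have LR := M_swap1 PI LM RL dPR.
have QR : Q \in (P |: L) :\ R by rewrite in_setD1 eq_sym RQ in_setU1 QL orbT.
have RVQ : R \in V Q.
  by rewrite in_V RQ.
have := M_swap1 RI LR QR; rewrite -lack_swap // => /(_ dQR).
rewrite setD1K //; by rewrite in_setU1 RL orbT.
Qed.

Definition new_circles := [set X |: L | X in pts, L in M X].

(** By [M_swap] a new circle does not depend on the point it was built from, so existence and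
    uniqueness can be checked in the derived structure at any of its points. *)
Lemma new_circle_at D P : D \in new_circles -> P \in D -> P \in pts /\ D :\ P \in M P.
Proof.
case/imset2P => X L XI LM ->; rewrite in_setU1.
have XL : X \notin L.
  by apply/negP => XL; have := M_V XI LM XL; rewrite in_V eqxx.
have [->|PX /= PL] := eqVneq P X; first by rewrite setU1K.
by split; [have [] := in_V_swap XI (M_V XI LM PL)|apply: M_swap].
Qed.

Lemma new_circle_uncovered D P Q R : D \in new_circles -> P \in D -> Q \in D ->
  R \in D -> P != Q -> P != R -> Q != R -> uncovered P Q R.
Proof.
move=> DN PD QD RD PQ PR QR; have [PI DM] := new_circle_at DN PD.
have QDP : Q \in D :\ P by rewrite in_setD1 eq_sym PQ.
have RDP : R \in D :\ P by rewrite in_setD1 eq_sym PR.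
rewrite -far_uncovered ?(M_V PI DM QDP) //; have [_ Mfar _ _] := decM PI.
exact: (Mfar (D :\ P)).
Qed.

Lemma completion : completable 3 (n ^ 2 + 1) (n + 1) 1 I.
Proof.
have [cI bs le1] := hI.
exists (Incidence pts (blocks I :|: new_circles)); split=> //; last exact: subsetUl.
split=> //= [D|S sS cS].
  rewrite in_setU => /orP [/bs //|/imset2P [X L XI LM ->]].
  have [Mn _ _ _] := decM XI; have [LV Ln] := Mn L LM.
  rewrite subUset sub1set XI cardsU1 Ln addn1 /=; split.
    by apply: subset_trans LV (subsetDl _ _).
  case: (boolP (X \in L)) => // XL; by have := M_V XI LM XL; rewrite in_V eqxx.
have /card_gt0P [P PS] : 0 < #|S| by rewrite cS.
have /cards2P [Q [R [QR SE]]] : #|S :\ P| == 2.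
  by have := cardsD1 P S; rewrite PS cS add1n => -[<-].
have QS : Q \in S :\ P by rewrite SE set21.
have RS : R \in S :\ P by rewrite SE set22.
have /setD1P [QP QS'] := QS; have /setD1P [RP RS'] := RS.
have subS (D : {set T}) : (S \subset D) = [&& P \in D, Q \in D & R \in D].
  by rewrite -(setD1K PS) SE !subUset !sub1set.
have PI := subsetP sS _ PS.
have QV : Q \in V P by rewrite in_V QP (subsetP sS).
have [/exists_inP [C CI PQR]|nC] :=
  boolP [exists C in blocks I, [&& P \in C, Q \in C & R \in C]].
  apply/eqP/cards1P; exists C; apply/setP => D; rewrite in_set1 in_set in_setU subS.
  apply/idP/eqP => [/andP [/orP [DI|DN] PQR']|->]; last by rewrite CI PQR.
    by apply: (card_le1_eqP (le1 S sS cS)); rewrite in_set ?CI ?DI subS.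
  have /and3P [PD QD RD] := PQR'.
  have : uncovered P Q R by apply: new_circle_uncovered DN PD QD RD _ _ QR;
    rewrite eq_sym.
  case/and5P=> _ _ _ _ /and3P [_ _] /exists_inP []; by exists C.
have unc : uncovered P Q R.
  by rewrite /uncovered PI !(subsetP sS) //= (eq_sym P Q) QP (eq_sym P R) RP QR.
have [_ _ Mcov Muniq] := decM PI.
have [L [LM QL RL]] : exists m, [/\ m \in M P, Q \in m & R \in m].
  by apply: Mcov => //; rewrite far_uncovered.
apply/eqP/cards1P; exists (P |: L); apply/setP => D;
  rewrite in_set1 in_set in_setU subS.
apply/idP/eqP => [/andP [/orP [DI|DN] PQR]|->].
- by case/exists_inP: nC; exists D.
- have /and3P [PD QD RD] := PQR; have [_ DM] := new_circle_at DN PD.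
  rewrite -(setD1K PD) (Muniq (D :\ P) L Q R) // !in_setD1.
    by rewrite QP QD.
  by rewrite RP RD.
apply/andP; split; last by rewrite !in_setU1 eqxx QL RL !orbT.
by apply/orP; right; apply/imset2P; exists P L.
Qed.

End Completion.

Theorem corollary2 (R : rcfType) (T : finType) (n : nat) (I : incidence T)
    (hn : 2 <= n)
    (hI : is_partial_design 3 (n ^ 2 + 1) (n + 1) 1 I)
    (hP : forall P : T, P \in points I ->
            [\/ cond_i R n I P, cond_ii n I P | cond_iii R n I P]) :
  completable 3 (n ^ 2 + 1) (n + 1) 1 I.
Proof.
have /fin_all_exists [f Hf] : forall P : T, exists x : nat * {set {set T}},
    P \in points I -> [/\ #|blocks (derived I P)| + x.1 = n ^ 2 + n,
      decomposes n (points (derived I P)) (blocks (derived I P)) x.2 &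
      #|deep n (points (derived I P)) (blocks (derived I P))| <= 1 \/ x.1 ^ 2 <= n].
  move=> P; have [PI|PI] := boolP (P \in points I); last by exists (0, set0).
  by have [e [M H]] := cond_decomposes hn hI PI (hP P PI); exists (e, M).
by apply: (@completion _ _ _ hn hI (fun P => (f P).1) (fun P => (f P).2)) => P /Hf [].
Qed.
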